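(* Let $n\ge 2$ be an integer, let $s\in(0,1)\setminus\{\tfrac12\}$, and let $f=(f_j)_{j=1}^n\in\mathcal{S}(\mathbb{R}^n;S^1(\mathbb{R}^n))$. If there exists a non-empty open set $U\subset\mathbb{R}^n$ such that $$f=\mathcal{A}^0_{1,s}f=\mathcal{A}^1_{1,s}f=0\ \text{ in } U,$$ then $f=0$ in $\mathbb{R}^n$.
   Context: $\mathcal{S}(\mathbb{R}^n;S^1(\mathbb{R}^n))$ is the space of vector fields on $\mathbb{R}^n$ with complex-valued Schwartz components. Repeated indices are summed from $1$ to $n$. The fractional divergent beam ray transform of $f$ is $(\chi_{s,1}f)(x,\xi)=\int_0^\infty t^{2s-1}f_j(x+t\xi)\xi^j\,dt$ for $x\in\mathbb{R}^n$, $\xi\in\mathbb{S}^{n-1}$. Its averages are $$\mathcal{A}^0_{1,s}f(x)=c^{1,0}_{n,s}\int_{\mathbb{S}^{n-1}}(\chi_{s,1}f)(x,\xi)\,dS_\xi,\qquad \mathcal{A}^{1,i}_{1,s}f(x)=c^{1,1}_{n,s}\int_{\mathbb{S}^{n-1}}\xi^i(\chi_{s,1}f)(x,\xi)\,dS_\xi,$$ and $\mathcal{A}^1_{1,s}f=(\mathcal{A}^{1,i}_{1,s}f)_{i=1}^n$, with the nonzero constants $$c^{1,0}_{n,s}=\frac{-\Gamma\left(\frac{n+1-2s}{2}\right)}{2^{2s}\pi^{n/2}\Gamma\left(s+\frac12\right)},\qquad c^{1,1}_{n,s}=\frac{-\Gamma\left(\frac{n+2-2s}{2}\right)}{2^{2s-1}\pi^{n/2}\Gamma(s)}.$$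 *)

(* Defs.v *)
From HB Require Import structures.
From mathcomp Require Import all_boot all_order all_algebra.
From mathcomp Require Import all_classical all_reals all_analysis.
From mathcomp Require Import measurable_realfun complex.

Set Implicit Arguments.
Unset Strict Implicit.
Unset Printing Implicit Defensive.

Import Order.TTheory GRing.Theory Num.Theory.
Import numFieldNormedType.Exports.

Local Open Scope classical_set_scope.
Local Open Scope ring_scope.
Local Open Scope complex_scope.

Section lebesgue_tuple.
Context (R : realType).
Notation RR := (measurableTypeR R).

Definition cons_pair n (p : RR * n.-tuple RR) : n.+1.-tuple RR :=
  [tuple of p.1 :: p.2].

Definition uncons_pair n (t : n.+1.-tuple RR) : RR * n.-tuple RR :=
  (thead t, [tuple of behead t]).

Lemma cons_pairK n : cancel (@cons_pair n) (@uncons_pair n).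
Proof.
move=> [x t]; rewrite /uncons_pair /cons_pair /=; congr pair.
exact: val_inj.
Qed.

Lemma measurable_cons_pair n : measurable_fun setT (@cons_pair n).
Proof. by apply: measurable_cons. Qed.

Lemma measurable_uncons_pair n : measurable_fun setT (@uncons_pair n).
Proof.
apply/measurable_fun_pairP; split.
  exact: (measurable_tnth ord0).
exact: measurable_behead.
Qed.

Section lebesgue_cons.
Context n (mu : {sigma_finite_measure set (n.-tuple RR) -> \bar R}).

Definition lebesgue_cons : set (n.+1.-tuple RR) -> \bar R :=
  pushforward (@lebesgue_measure R \x mu)%E (@cons_pair n).

HB.instance Definition _ := Measure.copy lebesgue_cons
  (measure_function_pushforward__canonical__measure_function_Measure
    (@lebesgue_measure R \x mu)%E (@measurable_cons_pair n)).

Let sfin : sigma_finite setT lebesgue_cons.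
Proof.
have /sigma_finiteP[F [TF ndF Foo]] := sigma_finiteT (@lebesgue_measure R).
have /sigma_finiteP[G [TG ndG Goo]] := sigma_finiteT mu.
exists (fun k => @uncons_pair n @^-1` (F k `*` G k)).
  apply/esym/seteqP; split => // t _.
  have [i _ Fi] : (\bigcup_i F i) (uncons_pair t).1 by rewrite -TF.
  have [j _ Gj] : (\bigcup_i G i) (uncons_pair t).2 by rewrite -TG.
  exists (maxn i j) => //; split.
  - by move: Fi; exact/subsetPset/ndF/leq_maxl.
  - by move: Gj; exact/subsetPset/ndG/leq_maxr.
move=> k; have [mFk Fk] := Foo k; have [mGk Gk] := Goo k; split.
  rewrite -[X in measurable X]setTI; apply: measurable_uncons_pair => //.
  exact: measurableX.
rewrite /lebesgue_cons /pushforward (_ : _ @^-1` _ = F k `*` G k); last first.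
  by apply/seteqP; split => p; rewrite /preimage /mkset cons_pairK.
by rewrite product_measure1E// lte_mul_pinfty// ge0_fin_numE.
Qed.

HB.instance Definition _ := Measure_isSigmaFinite.Build _ _ _ lebesgue_cons sfin.

End lebesgue_cons.

(* The n-fold product of the Lebesgue measure on R, i.e. Lebesgue measure on R^n. *)
Fixpoint lebesgue_tuple n : {sigma_finite_measure set (n.-tuple RR) -> \bar R} :=
  match n with
  | 0 => \d_ [tuple]
  | n.+1 => lebesgue_cons (lebesgue_tuple n)
  end.

Section sphere.
Context (n : nat).
Implicit Types (t : n.-tuple RR) (A : set (n.-tuple RR)).

Definition tnorm t : R := Num.sqrt (\sum_i tnth t i ^+ 2).

Definition tnormalize t : n.-tuple RR := [tuple (tnorm t)^-1 * tnth t i | i < n].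

Definition unit_sphere : set (n.-tuple RR) := [set t | tnorm t = 1].

Definition punctured_ball : set (n.-tuple RR) := [set t | 0 < tnorm t <= 1].

(* Surface measure of the unit sphere: n times the Lebesgue measure of the cone
   {r xi | 0 < r <= 1, xi \in A, |xi| = 1}, so that polar coordinates read
   dx = r^(n-1) dr dS. It is carried by unit_sphere. *)
Definition sphere_measure A : \bar R :=
  (n%:R%:E * lebesgue_tuple n (punctured_ball `&` tnormalize @^-1` A))%E.

Lemma measurable_tnorm : measurable_fun setT tnorm.
Proof.
rewrite (_ : tnorm = fun t => (\sum_i tnth t i ^+ 2) `^ 2^-1); last first.
  by apply/funext => t; rewrite powR12_sqrt// sumr_ge0// => i _; exact: sqr_ge0.
apply: (measurableT_comp (measurable_powR _)).
apply: measurable_sum => i; apply: measurable_funX.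
exact: measurable_tnth.
Qed.

Lemma measurable_tnormalize : measurable_fun setT tnormalize.
Proof.
apply/measurable_fun_tnthP => i.
rewrite (_ : _ \o _ = fun t => (tnorm t `^ (-1)) * tnth t i); last first.
  by apply/funext => t /=; rewrite tnth_mktuple powR_inv1// sqrtr_ge0.
apply: measurable_funM; last exact: measurable_tnth.
apply: (measurableT_comp (measurable_powR _)).
exact: measurable_tnorm.
Qed.

Lemma measurable_punctured_ball : measurable punctured_ball.
Proof.
rewrite (_ : punctured_ball = tnorm @^-1` `]0, 1]%classic); last first.
  by apply/seteqP; split => t /=; rewrite in_itv.
by rewrite -[X in measurable X]setTI; exact: measurable_tnorm.
Qed.

Let cone_measure : {measure set (n.-tuple RR) -> \bar R} :=
  measure_function_pushforward__canonical__measure_function_Measure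
    (mrestr (lebesgue_tuple n) measurable_punctured_ball) measurable_tnormalize.

Let m : {measure set (n.-tuple RR) -> \bar R} :=
  mscale (n%:R%:nng : {nonneg R}) cone_measure.

Let sphere_measureE : sphere_measure = m.
Proof.
by apply/funext => A; rewrite /sphere_measure setIC.
Qed.

Let sphere_measure0 : sphere_measure set0 = 0%E.
Proof. by rewrite sphere_measureE; exact: measure0. Qed.

Let sphere_measure_ge0 A : (0 <= sphere_measure A)%E.
Proof. by rewrite sphere_measureE; exact: measure_ge0. Qed.

Let sphere_measure_sigma_additive : semi_sigma_additive sphere_measure.
Proof.
by rewrite sphere_measureE; exact: measure_semi_sigma_additive.
Qed.

HB.instance Definition _ := isMeasure.Build _ _ _ sphere_measure
  sphere_measure0 sphere_measure_ge0 sphere_measure_sigma_additive.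

End sphere.

End lebesgue_tuple.

(* For an integrable integrand this is the usual complex integral. *)
Definition Cintegral d (T : measurableType d) (R : realType)
    (mu : {measure set T -> \bar R}) (D : set T) (g : T -> R[i]) : R[i] :=
  (\int[mu]_(x in D) complex.Re (g x)) +i* (\int[mu]_(x in D) complex.Im (g x)).

Definition Gamma (R : realType) (x : R) : R :=
  \int[lebesgue_measure]_(t in `]0, +oo[) (t `^ (x - 1) * expR (- t)).

Section schwartz.
Context (R : realType) (n : nat).
Implicit Type g : 'rV[R]_n -> R.

Definition partial (i : 'I_n) g : 'rV[R]_n -> R :=
  fun x => 'D_(delta_mx 0 i) g x.

(* partials [:: i1; ...; ik] g = d_i1 ... d_ik g *)
Definition partials (l : seq 'I_n) g : 'rV[R]_n -> R := foldr partial g l.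

(* All iterated partial derivatives exist and are differentiable everywhere. *)
Definition smooth g := forall l x, differentiable (partials l g) x.

(* As the partial derivatives of a smooth function commute, the derivatives
   indexed by words l are exactly those indexed by multi-indices. *)
Definition schwartz g := smooth g /\
  forall (a : 'I_n -> nat) (l : seq 'I_n), exists C : R, forall x : 'rV[R]_n,
    `| (\prod_i x 0 i ^+ a i) * partials l g x | <= C.

Definition schwartz_field (f : 'rV[R]_n -> 'rV[R[i]]_n) := forall j,
  schwartz (fun x => complex.Re (f x 0 j)) /\
  schwartz (fun x => complex.Im (f x 0 j)).

End schwartz.

Section beam_ray.
Context (R : realType) (n : nat) (s : R).
Implicit Types (f : 'rV[R]_n -> 'rV[R[i]]_n) (x xi : 'rV[R]_n).

Definition chi1 f x xi : R[i] :=
  Cintegral lebesgue_measure `]0, +oo[ (fun t : R =>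
    (t `^ (2 * s - 1))%:C * \sum_j f (x + t *: xi) 0 j * (xi 0 j)%:C).

Definition sphere_integral (g : 'rV[R]_n -> R[i]) : R[i] :=
  Cintegral (@sphere_measure R n) (@unit_sphere R n)
    (fun t => g (\row_i tnth t i)).

Definition c10 : R := - Gamma ((n%:R + 1 - 2 * s) / 2) /
  (2 `^ (2 * s) * pi `^ (n%:R / 2) * Gamma (s + 1 / 2)).

Definition c11 : R := - Gamma ((n%:R + 2 - 2 * s) / 2) /
  (2 `^ (2 * s - 1) * pi `^ (n%:R / 2) * Gamma s).

Definition average0 f x : R[i] :=
  c10%:C * sphere_integral (fun xi => chi1 f x xi).

Definition average1 f x : 'rV[R[i]]_n :=
  \row_i (c11%:C * sphere_integral (fun xi => (xi 0 i)%:C * chi1 f x xi)).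

End beam_ray.

(* Main.v *)
(** Write z = y - x, rho = 1/|z|, e = z/|z| and a = n - 2s. In polar coordinates,
    the i-th component of A^1 f (x) is a nonzero multiple of the integral of
    sum_j f_j(y) e_i e_j rho^a. As f = 0 on U, this integrand is smooth in x near
    a point b of U, so that all derivatives of the kernel in x also annihilate f
    near b. With H_ij = e_i e_j rho^a,
      (n - a) d_i (sum_k d_k H_kj) / (n - 1 - a) - sum_k d_k d_k H_ij
        = (n - 2 - a) delta_ij rho^(a + 2),
    hence rho^(a + 2), and by Laplacians every rho^(a + 2 + 2k), annihilates each
    component f_i. Differentiating along v shows that rho^(a + 2) times any
    polynomial in v.w and |w|^2 annihilates f_i at b, where w = z/|z|^2. These
    polynomials include the powers of c - |w - v|^2, which concentrate at the
    point y0 such that w = v; hence f_i(y0) = 0. *)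

(* The vanishing of f near b replaces any distribution theory. If f is zero on the box of half-width
   2r about b and x stays in the box of half-width r, only |y - x| >= r contributes, where all
   kernels are smooth and bounded. Differentiation under the integral is then dominated by a
   combination of the |f_j|, and can be repeated. Kernels are kept as syntax, so that a derivative
   is again a kernel and bounds follow by induction.

   The exponent comes from u^(2s-1) = u^(n-1) u^(-a). With a = n - 2s, the divisors are n - 1 - a =
   2s - 1, then n - 2 - a = 2s - 2, and for the Laplacian of rho^(a+p) the product (a + p)(p + 2 -
   2s) with p >= 2. The conditions on s keep all of them nonzero.

   The inversion w = z/|z|^2 serves two purposes: derivatives of radial powers produce precisely v.w
   and |w|^2, and w is bounded by 1/r on the support of f. One explicit polynomial, raised to high
   powers, can therefore isolate a point, and no density theorem is called for. All kernels are
   real, so real and imaginary parts of f are treated separately. *)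
Require Import Defs.
From HB Require Import structures.
From mathcomp Require Import all_boot all_order all_algebra.
From mathcomp Require Import all_classical all_reals all_analysis.
From mathcomp Require Import measurable_realfun complex ring lra.

Set Implicit Arguments.
Unset Strict Implicit.
Unset Printing Implicit Defensive.

Import Order.TTheory GRing.Theory Num.Theory.
Import numFieldNormedType.Exports.

Local Open Scope classical_set_scope.
Local Open Scope ring_scope.

(** * Lebesgue measure on R^n *)

Section lebesgue_tuple_theory.
Context (R : realType).
Notation RR := (measurableTypeR R).
Local Open Scope ereal_scope.

Lemma measurable_affine (c b : R) :
  measurable_fun setT ((fun x => c * x + b)%R : RR -> RR).
Proof. by apply: measurable_funD => //; apply: measurable_funM. Qed.

(** The measure [c] times the image of Lebesgue measure under [x |-> c x + b] agrees with Lebesgue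
    measure on half-open intervals, hence everywhere by uniqueness. *)
Lemma ge0_integral_affine (c b : R) (g : RR -> \bar R) : (0 < c)%R ->
  measurable_fun setT g -> (forall x, 0 <= g x) ->
  \int[@lebesgue_measure R]_x g (c * x + b)%R =
  c^-1%:E * \int[@lebesgue_measure R]_x g x.
Proof.
move=> c0 mg g0.
pose phi : RR -> RR := fun x => (c * x + b)%R.
have mphi : measurable_fun setT phi by exact: measurable_affine.
pose P : {measure set RR -> \bar R} :=
  measure_function_pushforward__canonical__measure_function_Measure
    (@lebesgue_measure R) mphi.
have ci0 : (0 <= c)%R by exact: ltW.
pose M := mscale (NngNum ci0) P.
have E (X : set RR) : measurable X -> lebesgue_measure X = M X.
  apply: lebesgue_measure_unique => {}X [[u v] _ <-] /=.
  rewrite /M /mscale /= /P /= /pushforward.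
  have -> : phi @^-1` `]u, v]%classic =
      `](((u - b) / c)%R), (((v - b) / c)%R)]%classic :> set R.
    apply/seteqP; split => x /=; rewrite !in_itv /= ltr_pdivrMr// ler_pdivlMr//;
      by rewrite ltrBlDr lerBrDr [(x * c)%R]mulrC.
  rewrite !lebesgue_measure_itv /= !lte_fin ltr_pM2r ?invr_gt0// ltrD2r.
  case: ifP => _; last by rewrite mule0.
  rewrite -!EFinD -EFinM -mulrBl opprB addrA subrK mulrCA.
  by rewrite divff ?gt_eqF// mulr1.
transitivity (\int[P]_x g x).
  by rewrite ge0_integral_pushforward.
rewrite [in RHS](eq_measure_integral M); last by move=> A mA _; exact: E.
rewrite /M ge0_integral_mscale//= muleA -EFinM mulVf ?gt_eqF//.
by rewrite mul1e.
Qed.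

Lemma lebesgue_tupleSE n (g : n.+1.-tuple RR -> \bar R) :
  measurable_fun setT g -> (forall t, 0 <= g t) ->
  \int[lebesgue_tuple R n.+1]_t g t =
  \int[@lebesgue_measure R]_x \int[lebesgue_tuple R n]_t g (cons_pair (x, t)).
Proof.
move=> mg g0.
pose P : {measure set (n.+1.-tuple RR) -> \bar R} :=
  measure_function_pushforward__canonical__measure_function_Measure
    (@lebesgue_measure R \x lebesgue_tuple R n) (@measurable_cons_pair R n).
rewrite (eq_measure_integral P)//.
rewrite ge0_integral_pushforward//; last exact: measurable_cons_pair.
rewrite preimage_setT fubini_tonelli1//.
- by apply: measurableT_comp => //; exact: measurable_cons_pair.
- by move=> x; exact: g0.
Qed.

(** One family covers both later uses: [b = 0] gives the dilations of polar coordinates, [c = 1] the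
    translation that moves the origin to [x]. *)
Definition taff n (c : R) (b t : n.-tuple RR) : n.-tuple RR :=
  [tuple (c * tnth t i + tnth b i)%R | i < n].

Lemma measurable_taff n c (b : n.-tuple RR) : measurable_fun setT (taff c b).
Proof.
apply/measurable_fun_tnthP => i.
rewrite (_ : _ \o _ = fun t => (c * tnth t i + tnth b i)%R); last first.
  by apply/funext => t /=; rewrite tnth_mktuple.
by apply: measurable_funD => //; apply: measurable_funM => //;
  exact: measurable_tnth.
Qed.

Lemma measurable_consr n x :
  measurable_fun setT (fun t : n.-tuple RR => cons_pair (x, t)).
Proof.
apply: (measurableT_comp (@measurable_cons_pair R n)).
exact: measurable_pair1.
Qed.

Lemma taff_cons n c (b : n.+1.-tuple RR) x t :
  taff c b (cons_pair (x, t)) =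
  cons_pair ((c * x + thead b)%R, taff c [tuple of behead b] t).
Proof.
apply: eq_from_tnth => i; rewrite tnth_mktuple.
case: (unliftP ord0 i) => [j|] ->.
  rewrite /cons_pair /= !tnthS tnth_mktuple tnth_behead.
  congr (_ + _)%R; congr (tnth b _).
  by apply: val_inj; rewrite /= inordK// ltnS ltn_ord.
by rewrite !tnth0.
Qed.

(** Induction on the dimension: Tonelli splits off one coordinate, which contributes one factor
    [c^-1]. *)
Lemma ge0_integral_taff n c (b : n.-tuple RR) (g : n.-tuple RR -> \bar R) :
  (0 < c)%R -> measurable_fun setT g -> (forall x, 0 <= g x) ->
  \int[lebesgue_tuple R n]_t g (taff c b t) =
  (c ^- n)%:E * \int[lebesgue_tuple R n]_t g t.
Proof.
move=> c0; elim: n b g => [|n IH] b g mg g0.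
  rewrite expr0 invr1 mul1e; apply: eq_integral => t _.
  by congr g; rewrite (tuple0 t) tuple0.
rewrite !lebesgue_tupleSE//; last first.
  by apply: measurableT_comp => //; exact: measurable_taff.
pose F (x : RR) := \int[lebesgue_tuple R n]_t g (cons_pair (x, t)).
have mF : measurable_fun setT F.
  apply: (@measurable_fun_fubini_tonelli_F _ _ _ _ _ (lebesgue_tuple R n)
    (g \o @cons_pair R n)).
    by apply: measurableT_comp => //; exact: measurable_cons_pair.
  by move=> x; exact: g0.
have F0 x : 0 <= F x by exact: integral_ge0.
transitivity (\int[@lebesgue_measure R]_x ((c ^- n)%:E * F (c * x + thead b)%R)).
  apply: eq_integral => x _.
  under eq_integral do rewrite taff_cons.
  rewrite (IH _ (fun t => g (cons_pair ((c * x + thead b)%R, t))))//.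
  by apply: measurableT_comp => //; exact: measurable_consr.
have mFc : measurable_fun setT (fun x : RR => F (c * x + thead b)%R).
  exact: (measurableT_comp mF (measurable_affine c (thead b))).
have k0 : 0 <= (c ^- n)%:E by rewrite lee_fin invr_ge0 exprn_ge0// ltW.
rewrite (ge0_integralZl _ measurableT mFc _ k0); last by move=> x _; exact: F0.
rewrite (ge0_integral_affine (thead b) c0 mF F0).
by rewrite muleA -EFinM -invfM -exprSr.
Qed.

End lebesgue_tuple_theory.

Section lebesgue_tuple_prod.
Context (R : realType).
Notation RR := (measurableTypeR R).
Notation leb := (@lebesgue_measure R).

Lemma measurable_prod_tnth n (h : 'I_n -> RR -> R) :
  (forall i, measurable_fun setT (h i)) ->
  measurable_fun setT (fun t : n.-tuple RR => \prod_i h i (tnth t i)).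
Proof.
move=> mh; apply: measurable_prod => i _.
exact: (measurableT_comp (mh i) (measurable_tnth i)).
Qed.

Lemma ge0_integral_prod_tnth n (h : 'I_n -> RR -> R) :
  (forall i, measurable_fun setT (h i)) -> (forall i x, 0 <= h i x) ->
  (\int[lebesgue_tuple R n]_t (\prod_i h i (tnth t i))%:E =
   \prod_i \int[leb]_x (h i x)%:E)%E.
Proof.
elim: n h => [|n IH] h mh h0.
  rewrite big_ord0 [LHS](eq_integral (cst 1%E)); last first.
    by move=> t _; rewrite big_ord0.
  by rewrite integral_dirac// diracT mul1e.
rewrite lebesgue_tupleSE; last 2 first.
- by apply/measurable_EFinP; apply: measurable_prod_tnth.
- by move=> t; rewrite lee_fin prodr_ge0.
rewrite big_ord_recl -(IH (fun i => h (lift ord0 i)))//.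
set K := (\int[lebesgue_tuple R n]_t _)%E.
transitivity (\int[leb]_x ((h ord0 x)%:E * K))%E.
  apply: eq_integral => x _.
  rewrite -ge0_integralZl//.
  - apply: eq_integral => t _; rewrite big_ord_recl -EFinM /cons_pair /=.
    by rewrite tnth0; under eq_bigr do rewrite tnthS.
  - apply/measurable_EFinP.
    by apply: (measurable_prod_tnth (h := fun i => h (lift ord0 i))).
  - by move=> t _; rewrite lee_fin prodr_ge0.
  - by rewrite lee_fin.
rewrite ge0_integralZr//.
- exact/measurable_EFinP.
- by move=> x _; rewrite lee_fin.
- by apply: integral_ge0 => t _; rewrite lee_fin prodr_ge0.
Qed.

Lemma prod_EFin (I : finType) (h : I -> R) :
  (\prod_i (h i)%:E = (\prod_i h i)%:E :> \bar R)%E.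
Proof. by rewrite (big_morph EFin (@EFinM R) erefl). Qed.

(** This is the integrable majorant for Schwartz functions; by Tonelli its integral is pi^n. *)
Lemma integrable_prod_oneDsqrV n :
  (lebesgue_tuple R n).-integrable setT
    (fun t => (\prod_i (oneDsqr (tnth t i))^-1)%:E).
Proof.
have mh : measurable_fun setT (fun x : RR => (oneDsqr x)^-1 : R).
  by apply: continuous_measurable_fun; exact: continuous_oneDsqrV.
have h0 (x : RR) : 0 <= (oneDsqr x)^-1 by rewrite invr_ge0.
apply/integrableP; split.
  apply/measurable_EFinP.
  exact: (measurable_prod_tnth (h := fun _ (x : RR) => (oneDsqr x)^-1)).
under eq_integral do rewrite gee0_abs ?lee_fin ?prodr_ge0//.
rewrite (ge0_integral_prod_tnth (h := fun _ (x : RR) => (oneDsqr x)^-1))//.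
have -> : (\int[leb]_x ((oneDsqr x)^-1)%:E = pi%:E :> \bar R)%E.
  rewrite ge0_symfun_integralT//=.
  - rewrite (_ : [set x | _] = `[0, +oo[%classic); last first.
      by apply/seteqP; split => x/=; rewrite in_itv/= andbT.
    by rewrite integral0y_oneDsqr -EFinM mulrCA divff// mulr1.
  - exact: continuous_oneDsqrV.
  - by move=> x/=; rewrite /oneDsqr sqrrN.
by rewrite prod_EFin ltry.
Qed.

(** Balls of the sup norm, which is the norm of ['rV[R]_n]; being products of intervals, their
    volume is a product as well. *)
Definition box n (b : n.-tuple RR) (d : R) : set (n.-tuple RR) :=
  [set t | forall i, `|tnth t i - tnth b i| < d].

Lemma measurable_box n (b : n.-tuple RR) (d : R) : measurable (box b d).
Proof.
rewrite (_ : box b d = \bigcap_(i : 'I_n)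
    ((fun t : n.-tuple RR => tnth t i) @^-1` [set x | `|x - tnth b i| < d])); last first.
  by apply/seteqP; split => [t H i _|t H i]; [exact: H|exact: (H i)].
apply: fin_bigcap_measurable => // i _.
rewrite -[X in measurable X]setTI; apply: measurable_tnth => //.
rewrite (_ : [set x | _] = ball (tnth b i) d); last first.
  by apply/seteqP; split => x /=; rewrite /ball /= distrC.
exact: measurable_ball.
Qed.

Lemma lebesgue_tuple_box_gt0 n (b : n.-tuple RR) (d : R) :
  0 < d -> (0 < lebesgue_tuple R n (box b d) < +oo)%E.
Proof.
move=> d0; pose h i (x : RR) : R := \1_(ball (tnth b i) d) x.
have mh i : measurable_fun setT (h i) by apply: measurable_indic; exact: measurable_ball.
rewrite -[X in lebesgue_tuple R n X]setIT -integral_indic//; last exact: measurable_box.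
rewrite (_ : (\int[_]_t _)%E =
    (\int[lebesgue_tuple R n]_t (\prod_i h i (tnth t i))%:E)%E); last first.
  apply: eq_integral => t _; congr EFin; rewrite indicE.
  have [tb|/negP tb] := boolP (t \in box b d).
    rewrite big1// => i _; rewrite /h indicE mem_set//.
    by rewrite /ball /= distrC; exact: (set_mem tb).
  have [i bi] : exists i, ~ `|tnth t i - tnth b i| < d.
    by apply/existsNP => H; apply: tb; exact: mem_set.
  rewrite (bigD1 i)//= {1}/h indicE memNset ?mul0r//.
  by rewrite /ball /= distrC.
rewrite ge0_integral_prod_tnth//.
have -> : (\prod_i \int[leb]_x (h i x)%:E = ((d *+ 2) ^+ n)%:E)%E.
  rewrite -[in RHS](card_ord n) -prodr_const -prod_EFin.
  apply: eq_bigr => i _; rewrite integral_indic//; last exact: measurable_ball.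
  by rewrite setIT; exact: (lebesgue_measure_ball (tnth b i) (ltW d0)).
by rewrite lte_fin exprn_gt0 ?ltry// pmulrn_lgt0.
Qed.

End lebesgue_tuple_prod.

(** * Schwartz functions *)

Section rowt.
Context (R : realType).
Notation RR := (measurableTypeR R).

Definition rowt n (t : n.-tuple RR) : 'rV[R]_n := \row_i tnth t i.

Lemma rowtE n (t : n.-tuple RR) i : rowt t 0 i = tnth t i.
Proof. by rewrite mxE. Qed.

Lemma near_rowt n (F : 'rV[R]_n -> R) (t : n.-tuple RR) (e : R) : 0 < e ->
  {for rowt t, continuous F} ->
  exists2 d : R, 0 < d & forall x : 'rV[R]_n,
    (forall i, `|tnth t i - x 0 i| < d) -> `|F (rowt t) - F x| < e.
Proof.
move=> e0 /cvgrPdist_lt /(_ e e0) /nbhs_ballP[d /= d0 dF].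
exists d => // x tx; apply: dF; split => // i j.
by rewrite (ord1 i) rowtE; exact: tx.
Qed.

Definition floort n (k : nat) (t : n.-tuple RR) : n.-tuple int :=
  [tuple Num.floor (k.+1%:R * tnth t i) | i < n].

Lemma measurable_floort n k (q : n.-tuple int) : measurable (@floort n k @^-1` [set q]).
Proof.
rewrite (_ : _ @^-1` _ = \bigcap_(i : 'I_n) ((fun t : n.-tuple RR => tnth t i) @^-1`
    `[(tnth q i)%:~R / k.+1%:R, (tnth q i + 1)%:~R / k.+1%:R[%classic)); last first.
  apply/seteqP; split => [t /= tq i _|t tq].
    rewrite /preimage /= in_itv /= ler_pdivrMr// ltr_pdivlMr//.
    by rewrite -tq tnth_mktuple [_ * k.+1%:R]mulrC floor_itv.
  apply: eq_from_tnth => i; rewrite tnth_mktuple; apply/eqP.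
  have := tq i I; rewrite /preimage /= in_itv /= ler_pdivrMr// ltr_pdivlMr//.
  by rewrite floor_eq [_ * k.+1%:R]mulrC.
apply: fin_bigcap_measurable => // i _.
rewrite -[X in measurable X]setTI; apply: measurable_tnth => //.
Qed.

(* A continuous function is the limit of its values on the grids
   [Z^n / (k + 1)], each of which depends on countably many cells. *)
Lemma continuous_measurable_rowt n (F : 'rV[R]_n -> R) : continuous F ->
  measurable_fun setT (fun t : n.-tuple RR => F (rowt t)).
Proof.
move=> cF; pose r k (q : n.-tuple int) : 'rV[R]_n := \row_i ((tnth q i)%:~R / k.+1%:R).
apply: (@measurable_fun_cvg _ _ _ setT (fun k t => F (r k (floort k t)))).
  move=> k _ Y mY; rewrite setTI.
  rewrite (_ : _ @^-1` _ = \bigcup_(q : n.-tuple int)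
      (if F (r k q) \in Y then @floort n k @^-1` [set q] else set0)); last first.
    apply/seteqP; split => [t /= Yt|t [q _]].
      by exists (floort k t) => //; rewrite mem_set.
    by case: ifPn => // qY /= ->; exact: set_mem.
  apply: countable_bigcupT_measurable => [|q]; first exact: countableP.
  case: ifPn => // _.
  exact: measurable_floort.
move=> t _; apply/cvgrPdist_lt => e e0.
have [d d0 dF] := near_rowt e0 (cF (rowt t)).
near=> k; apply: dF => i; rewrite mxE tnth_mktuple.
have k0 : (0 : R) < k.+1%:R by [].
have /andP[H1 H2] := floor_itv (k.+1%:R * tnth t i).
rewrite -(ltr_pM2l k0) -{1}(gtr0_norm k0) -normrM mulrBr [X in _ - X]mulrCA.
rewrite divff ?gt_eqF// mulr1.
rewrite ger0_norm ?subr_ge0// (@lt_trans _ _ 1)//.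
  by rewrite ltrBlDr -(intrD _ 1) addrC.
rewrite mulrC -ltr_pdivrMl// mulr1.
rewrite (@lt_trans _ _ k%:R)// ?ltr_nat//.
by near: k; exact: nbhs_infty_gtr.
Unshelve. all: by end_near. Qed.

Lemma schwartz_continuous n (g : 'rV[R]_n -> R) : schwartz g -> continuous g.
Proof. by move=> [sg _] x; apply/differentiable_continuous/(sg [::]). Qed.

(** Expanding the product of the [1 + x_i^2] over subsets [A] gives the monomials with [x_i^2] for
    [i] outside [A]. Each of them times [g] is bounded by the definition of Schwartz functions, and
    the bounds are added. *)
Lemma schwartz_decay n (g : 'rV[R]_n -> R) : schwartz g ->
  exists C, forall x, `|g x| <= C * \prod_i (oneDsqr (x 0 i))^-1.
Proof.
move=> [_ dg].
have /choice[C HC] : forall A : {set 'I_n}, exists C, forall x : 'rV[R]_n,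
    \prod_i (if i \in A then 1 else x 0 i ^+ 2) * `|g x| <= C.
  move=> A; have [C HC] := dg (fun i => if i \in A then 0%N else 2%N) [::].
  exists C => x; apply: le_trans (HC x); rewrite normrM ler_wpM2r//.
  rewrite normr_prod; apply: ler_prod => i _; apply/andP; split.
    by case: ifP => // _; exact: sqr_ge0.
  by case: ifP => _; rewrite ?expr0 ?normr1// ger0_norm// sqr_ge0.
exists (\sum_(A in {set 'I_n}) C A) => x.
rewrite prodfV ler_pdivlMr; last first.
  by apply: prodr_gt0 => i _; exact: lt_le_trans (oneDsqr_ge1 _).
rewrite mulrC bigA_distr mulr_suml.
by apply: ler_sum => A _; exact: HC.
Qed.

Lemma integrable_schwartz n (g : 'rV[R]_n -> R) : schwartz g ->
  (lebesgue_tuple R n).-integrable setT (EFin \o (fun t => g (rowt t))).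
Proof.
move=> sg; have [C HC] := schwartz_decay sg.
apply: (@le_integrable _ _ R (lebesgue_tuple R n) setT measurableT _
  (fun t => (C * \prod_i (oneDsqr (tnth t i))^-1)%:E)).
- apply/measurable_EFinP; apply: continuous_measurable_rowt.
  exact: schwartz_continuous.
- move=> t _; rewrite !abse_EFin lee_fin (le_trans (HC _))//.
  by under eq_bigr do rewrite rowtE; exact: ler_norm.
- under eq_fun do rewrite EFinM.
  by apply: integrableZl => //; exact: integrable_prod_oneDsqrV.
Qed.

End rowt.

(** * Kernels *)

Section dotp.
Context (R : realType) (n : nat).
Implicit Types u v z : 'rV[R]_n.

Definition dotp u v : R := \sum_i u 0 i * v 0 i.

Definition nrm z : R := Num.sqrt (dotp z z).

Lemma dotpC u v : dotp u v = dotp v u.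
Proof. by apply: eq_bigr => i _; rewrite mulrC. Qed.

Lemma dotpDr u v z : dotp u (v + z) = dotp u v + dotp u z.
Proof. by rewrite -big_split; apply: eq_bigr => i _; rewrite mxE mulrDr. Qed.

Lemma dotpZr c u v : dotp u (c *: v) = c * dotp u v.
Proof. by rewrite mulr_sumr; apply: eq_bigr => i _; rewrite mxE mulrCA. Qed.

Lemma dotpDl u v z : dotp (u + v) z = dotp u z + dotp v z.
Proof. by rewrite !(dotpC _ z) dotpDr. Qed.

Lemma dotpZl c u v : dotp (c *: u) v = c * dotp u v.
Proof. by rewrite !(dotpC _ v) dotpZr. Qed.

Lemma dotp_ge0 z : 0 <= dotp z z.
Proof. by apply: sumr_ge0 => i _; rewrite -expr2 sqr_ge0. Qed.

Lemma nrm_ge0 z : 0 <= nrm z. Proof. exact: sqrtr_ge0. Qed.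

Lemma nrm_sqr z : nrm z ^+ 2 = dotp z z. Proof. by rewrite sqr_sqrtr// dotp_ge0. Qed.

Lemma dotp_delta i z : dotp (delta_mx 0 i) z = z 0 i.
Proof.
rewrite /dotp (bigD1 i)//= big1 ?addr0 => [|j /negPf ji]; rewrite mxE !eqxx ?mul1r//.
by rewrite ji mul0r.
Qed.

Lemma coord_le_nrm z i : `|z 0 i| <= nrm z.
Proof.
rewrite -sqrtr_sqr ler_wsqrtr// /dotp (bigD1 i)//= -expr2 lerDl.
by apply: sumr_ge0 => j _; rewrite -expr2 sqr_ge0.
Qed.

(** A substitute for Cauchy-Schwarz with a worse constant; only the boundedness of the angular
    variables matters. *)
Lemma dotp_le_nrm v z : `|dotp v z| <= (\sum_i `|v 0 i|) * nrm z.
Proof.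
rewrite mulr_suml (le_trans (ler_norm_sum _ _ _))//; apply: ler_sum => i _.
by rewrite normrM ler_wpM2l// coord_le_nrm.
Qed.

Lemma is_derive_dotp_line v z u (h : R) :
  is_derive h 1 (fun h : R => dotp v (z + h *: u)) (dotp v u).
Proof.
rewrite (_ : (fun _ => _) = cst (dotp v z) + id * cst (dotp v u) :> (R -> R)); last first.
  by apply/funext => k; rewrite dotpDr dotpZr.
have H := is_deriveD (is_derive_cst (dotp v z) h 1)
  (is_deriveM (is_derive_id h 1) (is_derive_cst (dotp v u) h 1)).
by apply: is_derive_eq; rewrite scaler0 add0r scaler1 add0r.
Qed.

Lemma is_derive_nrm_line z u (h : R) : 0 < nrm (z + h *: u) ->
  is_derive h 1 (fun h : R => nrm (z + h *: u))
    (dotp u (z + h *: u) / nrm (z + h *: u)).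
Proof.
move=> N0; pose Q (k : R) := dotp (z + k *: u) (z + k *: u).
have dQ : is_derive h 1 Q (2 * dotp u (z + h *: u)).
  rewrite (_ : Q = cst (dotp z z) + id * cst (2 * dotp u z) +
      id ^+ 2 * cst (dotp u u) :> (R -> R)); last first.
    apply/funext => k.
    rewrite /Q !(dotpDr, dotpDl, dotpZr, dotpZl) (dotpC z u) !fctE /=; ring.
  have H := is_deriveD (is_deriveD (is_derive_cst (dotp z z) h 1)
      (is_deriveM (is_derive_id h 1) (is_derive_cst (2 * dotp u z) h 1)))
    (is_deriveM (is_deriveX 2 (is_derive_id h 1)) (is_derive_cst (dotp u u) h 1)).
  apply: is_derive_eq.
  rewrite !fctE /= dotpDr dotpZr !scaler0 !add0r !scaler1 /= expr1.
  by rewrite /GRing.scale /=; ring.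
have Q0 : 0 < Q h by rewrite -sqrtr_gt0.
have := is_derive1_comp (is_derive1_sqrt Q0) dQ.
rewrite (_ : _ \o _ = fun h : R => nrm (z + h *: u))//.
move=> H; apply: is_derive_eq => //.
by rewrite /nrm -/(Q h) invfM mulrACA mulVf// mul1r mulrC.
Qed.

End dotp.

(* Polynomials in the angular variables [v . z / |z|], in [1 / |z|] and in
   [|z|^(-a)]: all are bounded away from the origin, and this algebra is
   closed under directional derivatives. *)
Section kernels.
Context (R : realType) (n : nat) (a : R).
Implicit Types (u v z : 'rV[R]_n) (c : R).

Inductive kexpr :=
  KC of R | KL of 'rV[R]_n | KR | KP | KA of kexpr & kexpr | KM of kexpr & kexpr.
Implicit Type e : kexpr.

Fixpoint keval e z : R :=
  match e with
  | KC c => c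
  | KL v => dotp v z / nrm z
  | KR => (nrm z)^-1
  | KP => nrm z `^ (- a)
  | KA e1 e2 => keval e1 z + keval e2 z
  | KM e1 e2 => keval e1 z * keval e2 z
  end.

Lemma keval_iter p e1 e2 z :
  keval (iter p (KM e1) e2) z = keval e1 z ^+ p * keval e2 z.
Proof. by elim: p => [|p IH] /=; rewrite ?expr0 ?mul1r// IH mulrA -exprS. Qed.

(** Differentiation is done on syntax, so that iterated derivatives remain within reach of
    [keval_bounded] and [measurable_keval]. *)
Fixpoint kD u e : kexpr :=
  match e with
  | KC _ => KC 0
  | KL v => KM (KA (KC (dotp u v)) (KM (KC (-1)) (KM (KL u) (KL v)))) KR
  | KR => KM (KC (-1)) (KM (KL u) (KM KR KR))
  | KP => KM (KC (- a)) (KM (KL u) (KM KR KP))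
  | KA e1 e2 => KA (kD u e1) (kD u e2)
  | KM e1 e2 => KA (KM (kD u e1) e2) (KM e1 (kD u e2))
  end.

Lemma is_derive_keval e u z (h : R) : 0 < nrm (z + h *: u) ->
  is_derive h 1 (fun h : R => keval e (z + h *: u)) (keval (kD u e) (z + h *: u)).
Proof.
move=> N0; have N1 : nrm (z + h *: u) != 0 by rewrite gt_eqF.
have dN := is_derive_nrm_line N0.
have dV := @is_deriveV R (fun h : R => nrm (z + h *: u)) h _ 1 N1 dN.
elim: e => [c|v|||e1 IH1 e2 IH2|e1 IH1 e2 IH2] /=.
- exact: is_derive_cst.
- have := is_deriveM (is_derive_dotp_line v z u h) dV.
  rewrite (_ : _ * _ = fun h : R => dotp v (z + h *: u) / nrm (z + h *: u))//.
  move=> H; apply: is_derive_eq.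
  rewrite (dotpC v u) /GRing.scale /=; field; exact: N1.
- apply: is_derive_eq; rewrite /GRing.scale /=; field; exact: N1.
- have := @is_derive1_comp R (fun x => x `^ (- a)) (fun h : R => nrm (z + h *: u)) _ _ _
    (is_derive1_powR (- a) N0) dN.
  rewrite (_ : _ \o _ = fun h : R => nrm (z + h *: u) `^ (- a))//.
  move=> H; apply: is_derive_eq.
  rewrite powRD; last by rewrite N1 implybT.
  by rewrite powR_inv1 ?nrm_ge0//; ring.
- have := is_deriveD IH1 IH2.
  by rewrite (_ : _ + _ = fun h : R => keval e1 (z + h *: u) + keval e2 (z + h *: u)).
- have := is_deriveM IH1 IH2.
  rewrite (_ : _ * _ = fun h : R => keval e1 (z + h *: u) * keval e2 (z + h *: u))//.
  move=> H; apply: is_derive_eq.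
  by rewrite /GRing.scale /=; ring.
Qed.

(** Away from the origin the angular variables are bounded, and [1/|z|] and [|z|^(-a)] are at most
    their values at [|z| = r]. Applied to derivatives of kernels, this provides the domination for
    differentiating under the integral. *)
Lemma keval_bounded e (r : R) : 0 <= a -> 0 < r ->
  exists2 C, 0 <= C & forall z, r <= nrm z -> `|keval e z| <= C.
Proof.
move=> a0 r0.
elim: e => [c|v|||e1 [C1 C10 H1] e2 [C2 C20 H2]|e1 [C1 C10 H1] e2 [C2 C20 H2]] /=.
- by exists `|c|.
- exists (\sum_i `|v 0 i|) => [|z rz]; first exact: sumr_ge0.
  have N0 := lt_le_trans r0 rz.
  by rewrite normrM normfV (gtr0_norm N0) ler_pdivrMr// dotp_le_nrm.
- exists r^-1 => [|z rz]; first by rewrite invr_ge0 ltW.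
  have N0 := lt_le_trans r0 rz.
  by rewrite normfV (gtr0_norm N0) lef_pV2.
- exists (r `^ (- a)) => [|z rz]; first exact: powR_ge0.
  have N0 := lt_le_trans r0 rz.
  rewrite ger0_norm ?powR_ge0// !powRN lef_pV2 ?posrE ?powR_gt0//.
  by rewrite ge0_ler_powR// nnegrE ltW.
- exists (C1 + C2) => [|z rz]; first exact: addr_ge0.
  by rewrite (le_trans (ler_normD _ _))// lerD ?H1 ?H2.
- exists (C1 * C2) => [|z rz]; first exact: mulr_ge0.
  by rewrite normrM ler_pM ?H1 ?H2.
Qed.

Lemma measurable_keval e (x : 'rV[R]_n) :
  measurable_fun setT (fun t : n.-tuple (measurableTypeR R) => keval e (rowt t - x)).
Proof.
have mdot (v : 'rV[R]_n) : measurable_fun setT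
    (fun t : n.-tuple (measurableTypeR R) => dotp v (rowt t - x)).
  apply: measurable_sum => i; apply: measurable_funM => //.
  rewrite (_ : (fun _ => _) = fun t : n.-tuple (measurableTypeR R) => tnth t i - x 0 i).
    by apply: measurable_funB => //; exact: measurable_tnth.
  by apply/funext => t; rewrite !mxE.
have mN : measurable_fun setT (fun t : n.-tuple (measurableTypeR R) => nrm (rowt t - x)).
  rewrite (_ : (fun _ => _) = fun t : n.-tuple (measurableTypeR R) =>
      (\sum_i (tnth t i - x 0 i) ^+ 2) `^ 2^-1).
    apply: (measurableT_comp (measurable_powR _)).
    apply: measurable_sum => i; apply: measurable_funX.
    by apply: measurable_funB => //; exact: measurable_tnth.
  apply/funext => t; rewrite powR12_sqrt ?sumr_ge0// => [|i _]; last exact: sqr_ge0.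
  by congr Num.sqrt; apply: eq_bigr => i _; rewrite !mxE expr2.
have mV : measurable_fun setT (fun t : n.-tuple (measurableTypeR R) => (nrm (rowt t - x))^-1).
  rewrite (_ : (fun _ => _) = fun t : n.-tuple (measurableTypeR R) => nrm (rowt t - x) `^ (-1)).
    exact: (measurableT_comp (measurable_powR _)).
  by apply/funext => t; rewrite powR_inv1// nrm_ge0.
elim: e => [c|v|||e1 IH1 e2 IH2|e1 IH1 e2 IH2] //=.
- exact: measurable_funM.
- exact: (measurableT_comp (measurable_powR _)).
- exact: measurable_funD.
- exact: measurable_funM.
Qed.

End kernels.
Arguments KC {R n}.
Arguments KR {R n}.
Arguments KP {R n}.
Arguments KA {R n}.

(** * Kernels annihilating the field *)

Section annihilator.
Context (R : realType) (n : nat) (a : R) (F : 'I_n -> 'rV[R]_n -> R)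
  (b : 'rV[R]_n) (r : R).
Hypothesis a_ge0 : 0 <= a.
Hypothesis r_gt0 : 0 < r.
Hypothesis intF : forall j,
  (lebesgue_tuple R n).-integrable setT (fun t => (F j (rowt t))%:E).
Hypothesis F_eq0 : forall j (y : 'rV[R]_n),
  (forall i, `|y 0 i - b 0 i| < 2 * r) -> F j y = 0.
Implicit Types (K : 'I_n -> kexpr R n) (x y z u : 'rV[R]_n).

(** Half of the box on which [F] vanishes; the remaining margin [r] keeps [y - x] away from the
    singularity whenever [F j y] is nonzero. *)
Definition near_center x := forall i, `|x 0 i - b 0 i| < r.

Definition pairing K x y := \sum_j F j y * keval a (K j) (y - x).

Definition annihilates K := forall x, near_center x ->
  \int[lebesgue_tuple R n]_t pairing K x (rowt t) = 0.

Lemma F_far x y j : near_center x -> F j y != 0 -> r <= nrm (y - x).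
Proof.
move=> xb; apply: contra_neqT; rewrite -ltNge => yx; apply: F_eq0 => i.
rewrite (_ : y 0 i - b 0 i = (y - x) 0 i + (x 0 i - b 0 i)); last first.
  by rewrite !mxE addrA subrK.
rewrite (le_lt_trans (ler_normD _ _))// mulr2n mulrDl mul1r ltrD//.
exact: le_lt_trans (coord_le_nrm _ _) yx.
Qed.

Lemma integrable_term e x j : near_center x ->
  (lebesgue_tuple R n).-integrable setT
    (fun t => (F j (rowt t) * keval a e (rowt t - x))%:E).
Proof.
move=> xb; have [C C0 HC] := keval_bounded e a_ge0 r_gt0.
apply: (@le_integrable _ _ R (lebesgue_tuple R n) setT measurableT _
  (fun t => C%:E * (F j (rowt t))%:E)%E).
- apply/measurable_EFinP; apply: measurable_funM; last exact: measurable_keval.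
  by have /integrableP[/measurable_EFinP] := intF j.
- move=> t _; rewrite -EFinM !abse_EFin lee_fin !normrM mulrC (ger0_norm C0).
  have [->|Fj] := eqVneq (F j (rowt t)) 0; first by rewrite normr0 !mulr0.
  by rewrite ler_wpM2r// HC// (F_far xb Fj).
- by apply: integrableZl.
Qed.

Lemma integrable_pairing K x : near_center x ->
  (lebesgue_tuple R n).-integrable setT (fun t => (pairing K x (rowt t))%:E).
Proof.
move=> xb; under eq_fun do rewrite /pairing -sumEFin.
by apply: integrable_sum => // j _; exact: integrable_term.
Qed.

(** Where [F] is nonzero, [|y - x| >= r]. Kernel identities are thus needed only for [z] nonzero,
    and the values that division and powers take by convention at the origin do not matter. *)
Lemma eq_annihilates K1 K2 :
  (forall j z, 0 < nrm z -> keval a (K1 j) z = keval a (K2 j) z) ->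
  annihilates K1 -> annihilates K2.
Proof.
move=> K12 H x xb; rewrite -(H x xb); apply: eq_Rintegral => t _.
apply: eq_bigr => j _.
have [->|Fj] := eqVneq (F j (rowt t)) 0; first by rewrite !mul0r.
by rewrite K12// (lt_le_trans r_gt0)// (F_far xb Fj).
Qed.

Lemma annihilatesD K1 K2 : annihilates K1 -> annihilates K2 ->
  annihilates (fun j => KA (K1 j) (K2 j)).
Proof.
move=> H1 H2 x xb.
transitivity (\int[lebesgue_tuple R n]_t
    (pairing K1 x (rowt t) + pairing K2 x (rowt t))).
  apply: eq_Rintegral => t _; rewrite /pairing -big_split /=.
  by apply: eq_bigr => j _; rewrite mulrDr.
by rewrite RintegralD//; [rewrite H1// H2// addr0|exact: integrable_pairing..].
Qed.

Lemma annihilatesZ (c : R) K : annihilates K ->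
  annihilates (fun j => KM (KC c) (K j)).
Proof.
move=> H x xb.
transitivity (\int[lebesgue_tuple R n]_t (c * pairing K x (rowt t))).
  apply: eq_Rintegral => t _; rewrite /pairing mulr_sumr.
  by apply: eq_bigr => j _ /=; rewrite mulrCA.
by rewrite RintegralZl//; [rewrite H// mulr0|exact: integrable_pairing].
Qed.

Lemma annihilates0 : annihilates (fun=> KC 0).
Proof.
move=> x xb; rewrite /Rintegral integral0_eq// => t _.
by rewrite /pairing big1// => j _; rewrite mulr0.
Qed.

Lemma annihilates_sum (I : Type) (s : seq I) (K : I -> 'I_n -> kexpr R n) :
  (forall i, annihilates (K i)) ->
  annihilates (fun j => \big[KA/KC 0]_(i <- s) K i j).
Proof.
move=> H; elim: s => [|i s IH].
  by apply: eq_annihilates annihilates0 => j z _; rewrite big_nil.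
by apply: eq_annihilates (annihilatesD (H i) IH) => j z _; rewrite big_cons.
Qed.

(** The integral of the pairing is constantly zero for [x] near the centre, so its directional
    derivative vanishes; differentiation under the integral moves that derivative onto the
    kernel. *)
Lemma annihilates_kD u K : annihilates K -> annihilates (fun j => kD a u (K j)).
Proof.
move=> HK x xb.
(* The minus sign turns [y - y_ h] into [(y - x) + h u], so that the kernel is differentiated along
   [+u]. *)
pose y_ (h : R) := x - h *: u.
have [e e0 He] : exists2 e, 0 < e & forall h, `|h| < e -> near_center (y_ h).
  have [M M0 uM] : exists2 M, 0 < M & forall i, `|u 0 i| <= M.
    exists (nrm u + 1) => [|i]; first by rewrite ltr_wpDl// nrm_ge0.
    by rewrite (le_trans (coord_le_nrm u i))// lerDl.
  (* Sup-norm distance from [x] to the boundary of the open box, capped by [r]; a shift [h u] with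
     [|h| M < d] stays inside. *)
  pose d := \big[Num.min/r]_i (r - `|x 0 i - b 0 i|).
  have d0 : 0 < d.
    rewrite /d; elim/big_ind : _ => // [p q p0 q0|i _]; last by rewrite subr_gt0.
    by rewrite lt_min p0.
  exists (d / M) => [|h hd]; first exact: divr_gt0.
  move=> i; rewrite !mxE addrAC (le_lt_trans (ler_normB _ _))//.
  rewrite -ltrBrDl; apply: (@lt_le_trans _ _ d); last exact: bigmin_le_cond.
  rewrite ltr_pdivlMr// in hd; rewrite normrM (le_lt_trans _ hd)//.
  by rewrite ler_wpM2l.
pose f (h : R) (t : n.-tuple (measurableTypeR R)) := pairing K (y_ h) (rowt t).
have [C C0 HC] : exists2 C : 'I_n -> R, forall j, 0 <= C j &
    forall j z, r <= nrm z -> `|keval a (kD a u (K j)) z| <= C j.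
  have /choice[C HC] : forall j, exists C, 0 <= C /\
      forall z, r <= nrm z -> `|keval a (kD a u (K j)) z| <= C.
    by move=> j; have [C C0 H] := keval_bounded (kD a u (K j)) a_ge0 r_gt0; exists C.
  by exists C => j; have [] := HC j.
have nearI h : h \in `](- e), e[ -> near_center (y_ h).
  by rewrite in_itv /= -ltr_norml => /He.
have df h t : h \in `](- e), e[ ->
    is_derive h 1 (f ^~ t) (pairing (fun j => kD a u (K j)) (y_ h) (rowt t)).
  move=> hI.
  rewrite (_ : f ^~ t = \sum_j (fun h => F j (rowt t) * keval a (K j) (rowt t - y_ h))); last first.
    by apply/funext => k; rewrite fct_sumE.
  apply: is_derive_sum => j.
  have [->|Fj] := eqVneq (F j (rowt t)) 0.
    rewrite mul0r (_ : (fun _ => _) = cst 0); first exact: is_derive_cst.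
    by apply/funext => k; rewrite mul0r.
  have E k : rowt t - y_ k = (rowt t - x) + k *: u by rewrite /y_ opprB addrA addrAC.
  have N0 : 0 < nrm (rowt t - x + h *: u).
    by rewrite -E (lt_le_trans r_gt0)// (F_far (nearI _ hI) Fj).
  have := is_deriveZ (F j (rowt t)) (is_derive_keval a (K j) N0).
  rewrite E; congr (is_derive _ _ _ _).
  by apply/funext => k /=; rewrite E.
have I0 : (`](- e), e[%classic : set R) 0 by rewrite /= in_itv /= oppr_lt0 e0.
(* The bounds [C j] hold on all of [|z| >= r], so this majorant does not depend on [h]. *)
pose G t := \sum_j (`|F j (rowt t)| * C j).
have intf h : (`](- e), e[%classic : set R) h ->
    (lebesgue_tuple R n).-integrable setT (EFin \o f h).
  by move=> hI; exact: (integrable_pairing K (nearI _ hI)).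
have G0 t : 0 <= G t by apply: sumr_ge0 => j _; rewrite mulr_ge0.
have intG : (lebesgue_tuple R n).-integrable setT (EFin \o G).
  rewrite (_ : EFin \o G = fun t => (\sum_j (C j)%:E * `|(F j (rowt t))%:E|)%E).
    apply: integrable_sum => // j _; apply: integrableZl => //.
    exact: integrable_abse.
  apply/funext => t /=; rewrite -sumEFin; apply: eq_bigr => j _.
  by rewrite mulrC EFinM.
have dfE h t : h \in `](- e), e[ ->
    partial1of2 f h t = pairing (fun j => kD a u (K j)) (y_ h) (rowt t).
  by move=> hI; rewrite partial1of2E; have /@derive_val := df h t hI.
have Gub h t : (`](- e), e[%classic : set R) h -> setT t -> `|partial1of2 f h t| <= G t.
  move=> hI _; rewrite dfE// (le_trans (ler_norm_sum _ _ _))//.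
  apply: ler_sum => j _; rewrite normrM.
  have [->|Fj] := eqVneq (F j (rowt t)) 0; first by rewrite normr0 !mul0r.
  by rewrite ler_wpM2l// HC// (F_far (nearI _ hI) Fj).
have derf h t : (`](- e), e[%classic : set R) h -> setT t -> derivable (f ^~ t) h 1.
  by move=> hI _; have /@ex_derive := df h t hI.
have := cvg_differentiation_under_integral measurableT I0 intf derf G0 intG Gub.
rewrite (_ : \int[lebesgue_tuple R n]_y partial1of2 f 0 y =
    \int[lebesgue_tuple R n]_t pairing (fun j => kD a u (K j)) x (rowt t)); last first.
  by apply: eq_Rintegral => t _; rewrite dfE// /y_ scale0r subr0.
move=> lim.
(* The same difference quotients are identically zero for small [h]; uniqueness of limits gives the
   claim. *)
have lim0 : (fun h : R => h^-1 *: (\int[lebesgue_tuple R n]_t f (h + 0) t -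
    \int[lebesgue_tuple R n]_t f 0 t)) h @[h --> 0^'] --> (0 : R).
  apply: cvg_near_cst; near=> h.
  rewrite addr0 (HK (y_ h)); last by apply: He; near: h; exact: dnbhs0_lt.
  by rewrite (HK (y_ 0)) ?subrr ?scaler0//; apply: He; rewrite normr0.
exact: (cvg_unique _ lim lim0).
Unshelve. all: by end_near. Qed.

Lemma keval_sum (I : Type) (s : seq I) (e : I -> kexpr R n) z :
  keval a (\big[KA/KC 0]_(i <- s) e i) z = \sum_(i <- s) keval a (e i) z.
Proof. by elim/big_rec2 : _ => //= i p q _ ->. Qed.

Local Notation delta k := (delta_mx 0 k : 'rV[R]_n).
Local Notation ell k z := (dotp (delta k) z / nrm z).

Lemma dotp_deltas (i k : 'I_n) : dotp (delta k) (delta i) = (k == i)%:R.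
Proof. by rewrite dotp_delta mxE eqxx eq_sym. Qed.

Lemma dotp_delta1 (k : 'I_n) : dotp (delta k) (delta k) = 1.
Proof. by rewrite dotp_deltas eqxx. Qed.

Lemma sum_ell_sqr z : 0 < nrm z -> \sum_k ell k z * ell k z = 1.
Proof.
move=> z0; transitivity (dotp z z / nrm z ^+ 2); last first.
  by rewrite -nrm_sqr divff// expf_neq0// gt_eqF.
rewrite mulr_suml; apply: eq_bigr => k _.
by rewrite mulrACA -invfM -expr2 dotp_delta.
Qed.

(** With e = z/|z|, traces over [k] of first and second derivatives of the kernels involve only
    these five shapes, and are evaluated by |e| = 1 and contraction with Kronecker deltas. *)
Lemma sum_ell (A B C D E : R) (i j : 'I_n) z : 0 < nrm z ->
  \sum_k (A + B * (ell k z * ell k z) + C * (dotp (delta k) (delta i) * ell k z)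
    + D * (dotp (delta k) (delta j) * ell k z)
    + E * (dotp (delta k) (delta i) * dotp (delta k) (delta j))) =
  n%:R * A + B + C * ell i z + D * ell j z + E * (i == j)%:R.
Proof.
move=> z0; rewrite !big_split /= -!mulr_sumr sum_ell_sqr// mulr1.
have S (g : 'I_n -> R) (k : 'I_n) : \sum_l (dotp (delta l) (delta k) * g l) = g k.
  rewrite (bigD1 k)//= big1 => [|l /negPf lk]; rewrite dotp_deltas ?eqxx ?mul1r ?addr0//.
  by rewrite lk mul0r.
rewrite (S (fun l => ell l z)) (S (fun l => ell l z)).
rewrite (S (fun l => dotp (delta l) (delta j))) dotp_deltas.
by rewrite sumr_const card_ord -[A *+ n]mulr_natl.
Qed.

(** The matrix H_ij of the overview; [KL (delta i)] is the component e_i of the direction. *)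
Definition beam_kernel (i j : 'I_n) : kexpr R n :=
  KM (KM (KL (delta i)) (KL (delta j))) KP.

(** The divergence of H is (n - 1 - a) e_j rho^(a+1): the terms in the trace contribute n, -(2 + a)
    and 1. *)
Lemma annihilates_div : a != n%:R - 1 ->
  (forall i, annihilates (beam_kernel i)) ->
  annihilates (fun j => KM (KL (delta j)) (KM KR KP)).
Proof.
move=> an H.
have an' : n%:R - 1 - a != 0 by rewrite subr_eq0 eq_sym.
have S := annihilates_sum (index_enum 'I_n) (fun k => annihilates_kD (delta k) (H k)).
apply: eq_annihilates (annihilatesZ (n%:R - 1 - a)^-1 S) => j z z0.
rewrite [LHS]/= keval_sum -[RHS](mulKf an'); congr (_ * _).
have E := sum_ell (ell j z * (nrm z)^-1 * nrm z `^ (- a))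
  (- (2 + a) * (ell j z * (nrm z)^-1 * nrm z `^ (- a))) 0
  ((nrm z)^-1 * nrm z `^ (- a)) 0 j j z0.
transitivity (\sum_k ((ell j z * (nrm z)^-1 * nrm z `^ (- a)) +
  (- (2 + a) * (ell j z * (nrm z)^-1 * nrm z `^ (- a))) * (ell k z * ell k z) +
  0 * (dotp (delta k) (delta j) * ell k z) +
  ((nrm z)^-1 * nrm z `^ (- a)) * (dotp (delta k) (delta j) * ell k z) +
  0 * (dotp (delta k) (delta j) * dotp (delta k) (delta j)))).
  apply: eq_bigr => k _; rewrite /= dotp_delta1.
  ring.
rewrite E /=; ring.
Qed.

(** The derivative of e_j rho^(a+1) along i is (delta_ij - (a + 2) e_i e_j) rho^(a+2), and the
    Laplacian of H_ij is (2 delta_ij - (a + 2)(n - a) e_i e_j) rho^(a+2). The weight n - a cancels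
    the e_i e_j terms. What is left is diagonal, so the components of the field decouple. *)
Lemma annihilates_diag (i : 'I_n) : a != n%:R - 1 -> a != n%:R - 2 ->
  (forall i, annihilates (beam_kernel i)) ->
  annihilates (fun j => KM (KC (i == j)%:R) (KM KR (KM KR KP))).
Proof.
move=> a1 a2 H.
have a2' : n%:R - 2 - a != 0 by rewrite subr_eq0 eq_sym.
have D1 := annihilates_kD (delta i) (annihilates_div a1 H).
have S := annihilates_sum (index_enum 'I_n)
  (fun k => annihilates_kD (delta k) (annihilates_kD (delta k) (H i))).
have := annihilatesZ (n%:R - 2 - a)^-1
  (annihilatesD (annihilatesZ (n%:R - a) D1) (annihilatesZ (- 1) S)).
apply: eq_annihilates => j z z0.
rewrite [LHS]/= keval_sum -[RHS](mulKf a2'); congr (_ * _).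
pose q := (nrm z)^-1 * (nrm z)^-1 * nrm z `^ (- a).
(* The coefficients are those of the second derivative of H_ij along k, with q = rho^(a+2). *)
have E := sum_ell (- (2 + a) * (ell i z * ell j z) * q)
  ((2 + a) * (4 + a) * (ell i z * ell j z) * q)
  (- 2 * (2 + a) * ell j z * q) (- 2 * (2 + a) * ell i z * q) (2 * q) i j z0.
rewrite [X in _ + -1 * X](_ : _ = \sum_k (- (2 + a) * (ell i z * ell j z) * q +
  (2 + a) * (4 + a) * (ell i z * ell j z) * q * (ell k z * ell k z) +
  - 2 * (2 + a) * ell j z * q * (dotp (delta k) (delta i) * ell k z) +
  - 2 * (2 + a) * ell i z * q * (dotp (delta k) (delta j) * ell k z) +
  2 * q * (dotp (delta k) (delta i) * dotp (delta k) (delta j)))).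
  rewrite E /= dotp_deltas /q; ring.
apply: eq_bigr => k _; rewrite /= dotp_delta1 /q.
ring.
Qed.

(** * Kernels annihilating a single component *)

Section scalar.
Variable i : 'I_n.
Implicit Types e : kexpr R n.

(** A kernel for the component [F i] alone, embedded as a vector kernel with zeros elsewhere so that
    the preceding closure lemmas apply. *)
Definition annihilates1 e := annihilates (fun j => KM (KC (i == j)%:R) e).

Lemma eq_annihilates1 e1 e2 : (forall z, 0 < nrm z -> keval a e1 z = keval a e2 z) ->
  annihilates1 e1 -> annihilates1 e2.
Proof. by move=> H; apply: eq_annihilates => j z z0 /=; rewrite H. Qed.

Lemma annihilates1D e1 e2 : annihilates1 e1 -> annihilates1 e2 -> annihilates1 (KA e1 e2).
Proof.
move=> H1 H2; apply: eq_annihilates (annihilatesD H1 H2) => j z _ /=.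
by rewrite mulrDr.
Qed.

Lemma annihilates1Z (c : R) e : annihilates1 e -> annihilates1 (KM (KC c) e).
Proof.
move=> H; apply: eq_annihilates (annihilatesZ c H) => j z _ /=.
by rewrite mulrCA.
Qed.

Lemma annihilates1_sum (I : Type) (s : seq I) (e : I -> kexpr R n) :
  (forall k, annihilates1 (e k)) -> annihilates1 (\big[KA/KC 0]_(k <- s) e k).
Proof.
move=> H; apply: eq_annihilates (annihilates_sum s H) => j z _ /=.
by rewrite !keval_sum mulr_sumr.
Qed.

Lemma annihilates1_kD u e : annihilates1 e -> annihilates1 (kD a u e).
Proof.
move=> H; apply: eq_annihilates (annihilates_kD u H) => j z _ /=.
by rewrite mul0r add0r.
Qed.

Lemma annihilates1E e x : annihilates1 e -> near_center x ->
  \int[lebesgue_tuple R n]_t (F i (rowt t) * keval a e (rowt t - x)) = 0.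
Proof.
move=> He xb; rewrite -(He x xb); apply: eq_Rintegral => t _.
rewrite /pairing (bigD1 i)//= eqxx mul1r big1 ?addr0// => j /negPf ji.
by rewrite eq_sym ji mul0r mulr0.
Qed.

(** The power rho^(a+p). *)
Definition kradial p : kexpr R n := iter p (KM KR) KP.

Lemma keval_kradial p z : keval a (kradial p) z = (nrm z)^-1 ^+ p * nrm z `^ (- a).
Proof. exact: keval_iter. Qed.

Lemma keval_kD_kradial u p z : keval a (kD a u (kradial p)) z =
  - (a + p%:R) * (dotp u z / nrm z) * (nrm z)^-1 * keval a (kradial p) z.
Proof.
elim: p => [|p IH] /=; first by rewrite addr0; ring.
by rewrite IH -natr1; ring.
Qed.

(** With q = a + p, the Laplacian of |z|^(-q) is q (q + 2 - n) |z|^(-q-2), and the two hypotheses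
    make the factor invertible. *)
Lemma annihilates1_laplace p : 0 < a + p%:R -> a + p%:R + 2 - n%:R != 0 ->
  annihilates1 (kradial p) -> annihilates1 (kradial p.+2).
Proof.
move=> p0 pn H.
(* First derivative in closed form: for a variable [p] the syntactic derivative of [kradial p] does
   not reduce, so it could not be differentiated a second time by computation. *)
pose g k : kexpr R n := KM (KC (- (a + p%:R))) (KM (KL (delta k)) (kradial p.+1)).
have Hg k : annihilates1 (g k).
  apply: eq_annihilates1 (annihilates1_kD (delta k) H) => z _.
  by rewrite keval_kD_kradial /=; ring.
have c0 : (a + p%:R) * (a + p%:R + 2 - n%:R) != 0 by rewrite mulf_neq0// gt_eqF.
have := annihilates1Z ((a + p%:R) * (a + p%:R + 2 - n%:R))^-1
  (annihilates1_sum (index_enum 'I_n) (fun k => annihilates1_kD (delta k) (Hg k))).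
apply: eq_annihilates1 => z z0; rewrite [LHS]/= keval_sum -[RHS](mulKf c0).
congr (_ * _).
pose q := keval a (kradial p.+2) z.
transitivity (\sum_k (- (a + p%:R) * q +
  (a + p%:R) * (a + p%:R + 2) * q * (ell k z * ell k z))).
  apply: eq_bigr => k _; rewrite [LHS]/= keval_kD_kradial dotp_delta1 /q /=; ring.
rewrite big_split /= sumr_const card_ord -[_ *+ n]mulr_natl -mulr_sumr sum_ell_sqr// /q /=.
ring.
Qed.

(** This is (v.w)^m rho^(a+p) in the inverted variable w = z/|z|^2. *)
Definition kmonomial v m p : kexpr R n := iter m (KM (KM (KL v) KR)) (kradial p).

Lemma keval_kmonomial v m p z : keval a (kmonomial v m p) z =
  (dotp v z / nrm z * (nrm z)^-1) ^+ m * keval a (kradial p) z.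
Proof. exact: keval_iter. Qed.

(** Along v, the derivative of v.w is |v|^2 rho^2 - 2 (v.w)^2 and that of rho^q is -q (v.w) rho^q.
    At [m = 0] the truncated [m.-1] is multiplied by zero. *)
Lemma keval_kD_kmonomial v m p z : keval a (kD a v (kmonomial v m p)) z =
  m%:R * dotp v v * keval a (kmonomial v m.-1 p.+2) z
  - (2 * m%:R + a + p%:R) * keval a (kmonomial v m.+1 p) z.
Proof.
elim: m => [|m IH] /=; first by rewrite keval_kD_kradial; ring.
rewrite IH -natr1; case: m {IH} => [|m] /=; first by ring.
have -> : keval a (kmonomial v m p.+2) z = (dotp v z / nrm z * (nrm z)^-1) ^+ m *
    ((nrm z)^-1 * ((nrm z)^-1 * keval a (kradial p) z)) by rewrite keval_kmonomial.
rewrite keval_kmonomial; ring.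
Qed.

(** The derivative formula is solved for its term of degree [m.+1], whose coefficient 2m + a + p is
    positive. The other term has degree [m.-1] and radial order [p.+2], which is why all [p + k.*2]
    are carried along. *)
Lemma annihilates1_kmonomial v m p : 0 < a ->
  (forall k, annihilates1 (kradial (p + k.*2))) -> annihilates1 (kmonomial v m p).
Proof.
move=> a_gt0; suff H k : (forall k, annihilates1 (kradial (p + k.*2))) ->
    annihilates1 (kmonomial v m (p + k.*2)).
  by move=> Hr; have := H 0%N Hr; rewrite addn0.
(* Two consecutive degrees are proved together, since the recursion reaches back two steps. *)
move=> Hr; suff [] : annihilates1 (kmonomial v m (p + k.*2)) /\
  annihilates1 (kmonomial v m.+1 (p + k.*2)) by [].
have step l k' : annihilates1 (kmonomial v l (p + k'.*2)) ->
    (l%:R != 0 :> R -> annihilates1 (kmonomial v l.-1 (p + k'.*2).+2)) ->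
    annihilates1 (kmonomial v l.+1 (p + k'.*2)).
  set p' := (p + k'.*2)%N => H1 H2.
  have c0 : 2 * l%:R + a + p'%:R != 0.
    by rewrite gt_eqF// -addrA ltr_wpDl ?mulr_ge0// ltr_pwDl.
  (* In degree zero the lower term has coefficient zero, so the derivative alone yields degree
     one. *)
  have [l0|l0] := eqVneq (l%:R : R) 0.
    apply: eq_annihilates1 (annihilates1Z (- (2 * l%:R + a + p'%:R)^-1)
      (annihilates1_kD v H1)) => z _.
    rewrite [LHS]/= keval_kD_kmonomial l0 mul0r mul0r add0r mulrNN mulrA.
    by rewrite -l0 mulVf// mul1r.
  apply: eq_annihilates1 (annihilates1Z (- (2 * l%:R + a + p'%:R)^-1)
    (annihilates1D (annihilates1_kD v H1)
      (annihilates1Z (- (l%:R * dotp v v)) (H2 l0)))) => z _.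
  rewrite [LHS]/= keval_kD_kmonomial; field; exact: c0.
elim: m k => [|m IH] k.
  split; first exact: Hr.
  by apply: step => [|]; [exact: Hr|rewrite eqxx].
have [IH1 IH2] := IH k; split => //.
apply: step => // _; have [+ _] := IH k.+1.
by rewrite doubleS !addnS.
Qed.

(** As |w| = 1/|z|, this is c + 2 v.w - |w|^2 = c + |v|^2 - |w - v|^2, largest where w = v. *)
Definition kpeak c v : kexpr R n :=
  KA (KC c) (KA (KM (KC 2) (KM (KL v) KR)) (KM (KC (- 1)) (KM KR KR))).

(** Multiplying out one factor of the peak sends [(m, p)] to [(m, p)], [(m.+1, p)] and [(m, p.+2)];
    hence the induction on [N] with [m] and [p] general. *)
Lemma annihilates1_kpeak c v N m p : 0 < a ->
  (forall k, annihilates1 (kradial (p + k.*2))) ->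
  annihilates1 (iter N (KM (kpeak c v)) (kmonomial v m p)).
Proof.
move=> a_gt0; elim: N m p => [|N IH] m p Hr; first exact: annihilates1_kmonomial.
have Hr2 k : annihilates1 (kradial (p.+2 + k.*2)).
  by have := Hr k.+1; rewrite doubleS !addnS.
apply: eq_annihilates1 (annihilates1D (annihilates1Z c (IH m p Hr))
  (annihilates1D (annihilates1Z 2 (IH m.+1 p Hr)) (annihilates1Z (- 1) (IH m p.+2 Hr2)))).
move=> z _ /=.
rewrite !(keval_iter _ N (kpeak c v)); set T := keval a (kpeak c v) z ^+ N.
rewrite [keval a (KM _ _) z]/= !keval_kmonomial [keval a (kradial p.+2) z]/=.
ring.
Qed.

End scalar.

End annihilator.

(** * Concentration of powers *)

Section peak.
Context d (T : measurableType d) (R : realType) (mu : {measure set T -> \bar R}).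

(** A zero integral would force the positive function to vanish almost everywhere on [S], placing
    [S] inside a null set. *)
Lemma Rintegral_pos_gt0 (S : set T) (phi : T -> R) : measurable S ->
  mu.-integrable S (EFin \o phi) -> (forall t, S t -> 0 < phi t) ->
  (0 < mu S)%E -> 0 < \int[mu]_(t in S) phi t.
Proof.
move=> mS iphi phi0 S0; rewrite lt0r Rintegral_ge0 ?andbT; last first.
  by move=> t /phi0 /ltW.
have mphi : measurable_fun S (EFin \o phi) by case/integrableP : iphi.
apply/eqP => /esym I0.
have : (\int[mu]_(t in S) `|(EFin \o phi) t| = 0)%E.
  rewrite -[RHS]/(0%:E) I0 /Rintegral fineK; last exact: integrable_fin_num.
  apply: eq_integral => t /set_mem /phi0 pt.
  by rewrite /= gtr0_norm.
move=> /(ae_eq_integral_abs mu mS mphi)[A [mA A0 SA]].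
have SsubA : S `<=` A.
  move=> t St; apply: SA => /= /(_ St) /eqP; rewrite eqe.
  by rewrite gt_eqF// phi0.
have : (mu S <= mu A)%E by apply: le_measure => //; rewrite inE.
by rewrite A0 leNgt S0.
Qed.

(* As [N] grows, [tau ^ N] concentrates on [S], where [phi] is positive. *)
Lemma peak_contradiction (phi tau : T -> R) (S B : set T) (alpha beta c : R) :
  mu.-integrable setT (EFin \o phi) -> measurable_fun setT tau ->
  measurable S -> (0 < mu S)%E -> (forall t, S t -> 0 < phi t) ->
  (forall t, B t -> 0 <= phi t) ->
  0 <= alpha -> alpha < beta ->
  (forall t, phi t != 0 -> 0 <= tau t <= c) ->
  (forall t, S t -> beta <= tau t) ->
  (forall t, ~ B t -> phi t != 0 -> tau t <= alpha) ->
  (forall N, \int[mu]_t (phi t * tau t ^+ N) = 0) -> False.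
Proof.
move=> iphi mtau mS S0 phiS phiB a0 ab tauc tauS tauB I0.
have iphiS : mu.-integrable S (EFin \o phi) by exact: integrableS iphi.
have mphi : measurable_fun setT phi by case/integrableP : iphi => /measurable_EFinP.
have IS0 := Rintegral_pos_gt0 mS iphiS phiS S0.
set IS := \int[mu]_(t in S) phi t in IS0.
pose I := \int[mu]_t `|phi t|.
have b0 : 0 < beta by exact: le_lt_trans a0 ab.
have iabs : mu.-integrable setT (EFin \o (fun t => `|phi t|)) by exact: integrable_norm.
have iind : mu.-integrable setT (EFin \o (phi \_ S)).
  have := iphiS; rewrite (integrable_mkcond _ mS).
  by congr (_.-integrable _ _); apply/funext => t; rewrite /= !patchE; case: ifP.
(* Pointwise, [beta^N phi 1_S - alpha^N |phi| <= phi tau^N]: on [S] since [tau >= beta], on the rest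
   of [B] since [phi >= 0], and off [B] since [tau <= alpha] wherever [phi] is nonzero. The right
   side integrates to zero. *)
have bound N : beta ^+ N * IS <= alpha ^+ N * I.
  rewrite -subr_le0 -(I0 N) /IS Rintegral_mkcond -RintegralZl// -RintegralZl//.
  rewrite -RintegralB//; last 2 first.
  - by apply: (@integrableZl _ _ _ mu setT measurableT (beta ^+ N) (EFin \o (phi \_ S))).
  - by apply: (@integrableZl _ _ _ mu setT measurableT (alpha ^+ N) (EFin \o (fun t => `|phi t|))).
  apply: le_Rintegral => //.
  - apply: (@integrableB _ _ _ mu setT measurableT (EFin \o (fun t => beta ^+ N * (phi \_ S) t))
       (EFin \o (fun t => alpha ^+ N * `|phi t|))).
    + by apply: (@integrableZl _ _ _ mu setT measurableT (beta ^+ N) (EFin \o (phi \_ S))).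
    + by apply: (@integrableZl _ _ _ mu setT measurableT (alpha ^+ N) (EFin \o (fun t => `|phi t|))).
  - apply: (@le_integrable _ _ _ mu setT measurableT _ (EFin \o (fun t => c ^+ N * `|phi t|))).
    + apply/measurable_EFinP; apply: measurable_funM => //.
      exact: measurable_funX.
    + move=> t _; rewrite !abse_EFin lee_fin normrM mulrC normrM normr_id normrX.
      have [->|p0] := eqVneq (phi t) 0; first by rewrite normr0 !mulr0.
      have /andP[t0 tc] := tauc t p0.
      rewrite ler_wpM2r// normrX lerXn2r ?nnegrE// (ger0_norm t0).
      by rewrite (le_trans tc)// ler_norm.
    + by apply: (@integrableZl _ _ _ mu setT measurableT (c ^+ N) (EFin \o (fun t => `|phi t|))).
  move=> t _; rewrite patchE.
  have aN : 0 <= alpha ^+ N * `|phi t| by rewrite mulr_ge0// exprn_ge0.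
  case: ifPn => [/set_mem St|_].
    rewrite lerBlDr (le_trans _ (_ : phi t * tau t ^+ N <= _)) ?lerDl//.
    rewrite mulrC ler_pM2l ?phiS// lerXn2r ?nnegrE ?(ltW b0) ?tauS//.
    by rewrite (le_trans (ltW b0))// tauS.
  rewrite mulr0 sub0r.
  have [->|p0] := eqVneq (phi t) 0; first by rewrite normr0 mulr0 oppr0 mul0r.
  have /andP[t0 tc] := tauc t p0.
  have [Bt|Bt] := pselect (B t).
    by rewrite (@le_trans _ _ 0) ?oppr_le0// mulr_ge0 ?exprn_ge0 ?phiB.
  rewrite lerNl -mulNr (@le_trans _ _ (`|phi t| * tau t ^+ N))//.
    by rewrite ler_wpM2r ?exprn_ge0// -normrN ler_norm.
  by rewrite mulrC ler_wpM2r// lerXn2r ?nnegrE// tauB.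
(* After division by [beta^N], the bound reads [IS <= I (alpha / beta)^N], which tends to 0 and
   contradicts [IS > 0]. *)
have q1 : `|alpha / beta| < 1.
  by rewrite ger0_norm ?divr_ge0// ?(ltW b0)// ltr_pdivrMr// mul1r.
have : I * (alpha / beta) ^+ N @[N --> \oo] --> I * 0.
  by apply: cvgM; [exact: cvg_cst|exact: cvg_expr].
rewrite mulr0 => /cvgrPdist_lt /(_ _ IS0)[N _ /(_ N (leqnn N))] /=.
rewrite sub0r normrN => /(le_lt_trans (ler_norm _)).
rewrite ltNge => /negP; apply.
by rewrite expr_div_n mulrA ler_pdivlMr ?exprn_gt0// mulrC [I * _]mulrC.
Qed.

End peak.

(** * Vanishing of a component annihilated by radial powers *)

Section vanishing.
Context (R : realType) (n : nat) (a : R) (F : 'I_n -> 'rV[R]_n -> R)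
  (b : 'rV[R]_n) (r : R).
Hypothesis a_gt0 : 0 < a.
Hypothesis r_gt0 : 0 < r.
Hypothesis intF : forall j,
  (lebesgue_tuple R n).-integrable setT (fun t => (F j (rowt t))%:E).
Hypothesis F_eq0 : forall j (y : 'rV[R]_n),
  (forall i, `|y 0 i - b 0 i| < 2 * r) -> F j y = 0.

(** The difference of the two sides is |x - 2y|^2. *)
Lemma dotp_le2 (x y : 'rV[R]_n) : dotp x x <= 2 * dotp (x - y) (x - y) + 2 * dotp y y.
Proof.
have := dotp_ge0 (x - 2 *: y).
rewrite -(scaleN1r y) -scaleNr !(dotpDl, dotpDr, dotpZl, dotpZr) (dotpC y x).
move=> H; rewrite -subr_ge0; apply: le_trans H _.
by rewrite le_eqVlt; apply/orP; left; apply/eqP; ring.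
Qed.

Lemma dotpN (x : 'rV[R]_n) : dotp (- x) (- x) = dotp x x.
Proof. by rewrite -scaleN1r dotpZl dotpZr !mulN1r opprK. Qed.

(* In the inverted variable [w = z / |z|^2], [kpeak] is [c - |w - w0|^2]. *)
Lemma keval_kpeak (c : R) (z z0 : 'rV[R]_n) : 0 < nrm z -> 0 < nrm z0 ->
  keval a (kpeak (c - (dotp z0 z0)^-1) ((dotp z0 z0)^-1 *: z0)) z =
  c - dotp (z - z0) (z - z0) / (dotp z z * dotp z0 z0).
Proof.
move=> z_gt0 z0_gt0; rewrite /= dotpZl.
have N1 : nrm z != 0 by rewrite gt_eqF.
have N2 : nrm z0 != 0 by rewrite gt_eqF.
rewrite -(scaleN1r z0) !(dotpDl, dotpDr, dotpZl, dotpZr) (dotpC z z0) -!nrm_sqr.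
by field; rewrite N1 N2.
Qed.

(** If [F i y0] were nonzero, [F i] would keep its sign on a box around [y0]. Times that sign and
    the positive kernel rho^(a+2), it is the density to which [peak_contradiction] applies, with
    thresholds measured by |w - w0|^2 = |z - z0|^2 / (|z|^2 |z0|^2). *)
Lemma annihilates1_kradial_eq0 i :
  (forall k, annihilates1 a F b r i (kradial R n (2 + k.*2))) ->
  continuous (F i) -> forall y, F i y = 0.
Proof.
move=> Hr cF y0; apply/eqP; apply: contraT => Fy0.
pose t0 : n.-tuple (measurableTypeR R) := [tuple y0 0 k | k < n].
have rt0 : rowt t0 = y0 by apply/rowP => k; rewrite rowtE tnth_mktuple.
have a_ge0 := ltW a_gt0.
have bb : near_center b r b by move=> k; rewrite subrr normr0.
pose z0 := y0 - b.
have rz0 : r <= nrm z0 by exact: (F_far F_eq0 bb Fy0).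
have z0_gt0 : 0 < nrm z0 by exact: lt_le_trans rz0.
pose q0 := dotp z0 z0.
have q0_gt0 : 0 < q0 by rewrite /q0 -nrm_sqr exprn_gt0.
have Fy0n : 0 < `|F i y0| by rewrite normr_gt0.
have [d d0 dF] := near_rowt Fy0n (cF (rowt t0)).
rewrite rt0 in dF.
pose sg := Num.sg (F i y0).
have sgF (y : 'rV[R]_n) : (forall k, `|y0 0 k - y 0 k| < d) -> 0 < sg * F i y.
  move=> yd; have : `|F i y0 - F i y| < `|F i y0|.
    by apply: dF => k; rewrite tnth_mktuple.
  rewrite /sg; have [F0|F0|F0] := ltgtP (F i y0) 0; last by rewrite F0 eqxx in Fy0.
    by rewrite ltr0_sg// (ltr0_norm F0) ltr_norml; lra.
  by rewrite gtr0_sg// (gtr0_norm F0) ltr_norml; lra.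
(* Chosen so that [tau >= 0] wherever [F i] is nonzero: there |w - w0|^2 <= 2|w|^2 + 2|w0|^2 with
   |w| <= 1/r and |w0|^2 = 1/q0. *)
pose c := 2 / r ^+ 2 + 2 / q0.
pose v := q0^-1 *: z0.
pose E (z : 'rV[R]_n) := dotp (z - z0) (z - z0).
have E_ge0 z : 0 <= E z by exact: dotp_ge0.
pose tau (t : n.-tuple (measurableTypeR R)) := keval a (kpeak (c - q0^-1) v) (rowt t - b).
pose phi (t : n.-tuple (measurableTypeR R)) :=
  sg * (F i (rowt t) * keval a (kradial R n 2) (rowt t - b)).
have phiF t : phi t != 0 -> F i (rowt t) != 0.
  by apply: contraNneq => F0; rewrite /phi F0 mul0r mulr0.
have Ffar (y : 'rV[R]_n) : F i y != 0 -> r <= nrm (y - b) by exact: (F_far F_eq0 bb).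
have tauE t : F i (rowt t) != 0 ->
    tau t = c - E (rowt t - b) / (dotp (rowt t - b) (rowt t - b) * q0).
  by move=> /Ffar ry; rewrite /tau keval_kpeak// (lt_le_trans r_gt0).
(* Outside the box of half-width [d] one has E >= d^2, so |z|^2 <= 2E + 2 q0 <= (2 + 2 q0/d^2) E,
   and |w - w0|^2 = E/(|z|^2 q0) is at least 1/X, called [eta] below. Its bound by 2/q0 gives
   [c - eta >= 0]. *)
pose X := q0 * (2 + 2 * q0 / d ^+ 2).
have X_gt0 : 0 < X.
  by rewrite mulr_gt0// ltr_pwDl// mulr_ge0 ?invr_ge0 ?mulr_ge0 ?exprn_ge0// ltW.
pose eta := X^-1.
have eta_gt0 : 0 < eta by rewrite invr_gt0.
have eta_le : eta <= 2 / q0.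
  rewrite /eta /X invfM mulrC ler_pM2r ?invr_gt0// invf_ple ?posrE//; last first.
    by rewrite ltr_pwDl// mulr_ge0 ?invr_ge0 ?mulr_ge0 ?exprn_ge0// ltW.
  have : 0 <= 2 * q0 / d ^+ 2 by rewrite mulr_ge0 ?invr_ge0 ?mulr_ge0 ?exprn_ge0// ltW.
  by lra.
(* If E <= q0/4 then |z|^2 >= q0/4; if moreover E <= eta q0^2 / 8, then |w - w0|^2 <= eta/2. *)
pose m := Num.min (q0 / 4) (eta * q0 ^+ 2 / 8).
have m_gt0 : 0 < m.
  by rewrite lt_min !divr_gt0// mulr_gt0// exprn_gt0.
(* On the box of half-width [d'], E <= n d'^2 <= m; the cap 1 gives d'^2 <= d', and [n.+1] keeps the
   divisor positive. *)
pose d' := Num.min d (Num.min 1 (m / n.+1%:R)).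
have d'_gt0 : 0 < d' by rewrite !lt_min d0 ltr01 divr_gt0//.
have d'm : n%:R * d' ^+ 2 <= m.
  have dm : d' <= m / n.+1%:R by rewrite /d' !ge_min lexx !orbT.
  have d1 : d' <= 1 by rewrite /d' !ge_min lexx !orbT.
  rewrite ler_pdivlMr// mulrC -natr1 in dm.
  have : d' ^+ 2 <= d' by rewrite expr2 ger_pMr.
  move=> /(ler_wpM2l (ler0n R n)); nra.
have posS t : box t0 d t -> 0 < sg * F i (rowt t).
  by move=> tb; apply: sgF => k; rewrite rowtE distrC; have := tb k; rewrite tnth_mktuple.
exfalso; apply: (@peak_contradiction _ _ R (lebesgue_tuple R n) phi tau
  (box t0 d') (box t0 d) (c - eta) (c - eta / 2) c).
- apply: (@integrableZl _ _ _ (lebesgue_tuple R n) setT measurableT sg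
    (fun t => (F i (rowt t) * keval a (kradial R n 2) (rowt t - b))%:E)).
  exact: (integrable_term a_ge0 r_gt0 intF F_eq0).
- exact: measurable_keval.
- exact: measurable_box.
- by have /andP[] := lebesgue_tuple_box_gt0 t0 d'_gt0.
- move=> t tb; have F0 : 0 < sg * F i (rowt t).
    by apply: posS => k; apply: lt_le_trans (tb k) _; rewrite /d' ge_min lexx.
  have Ft : F i (rowt t) != 0 by apply: contraTneq F0 => ->; rewrite mulr0 ltxx.
  rewrite /phi mulrA mulr_gt0// keval_kradial mulr_gt0 ?exprn_gt0 ?invr_gt0 ?powR_gt0//;
    exact: lt_le_trans (Ffar _ Ft).
- move=> t tb; rewrite /phi mulrA mulr_ge0//.
    exact/ltW/posS.
  by rewrite keval_kradial mulr_ge0 ?powR_ge0// exprn_ge0// invr_ge0 nrm_ge0.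
- have : 0 <= 2 / r ^+ 2 by rewrite divr_ge0// exprn_ge0// ltW.
  by rewrite /c; lra.
- by lra.
- move=> t /phiF Ft; rewrite tauE//.
  have zr := Ffar _ Ft.
  set z := rowt t - b in zr *.
  have qz : r ^+ 2 <= dotp z z by rewrite -nrm_sqr lerXn2r ?nnegrE ?nrm_ge0// ltW.
  have r2 : 0 < r ^+ 2 by rewrite exprn_gt0.
  have qz_gt0 : 0 < dotp z z by exact: lt_le_trans qz.
  apply/andP; split; last first.
    by rewrite gerBl divr_ge0// mulr_ge0 ?dotp_ge0// ltW.
  rewrite subr_ge0 ler_pdivrMr; last exact: mulr_gt0.
  have : E z <= 2 * dotp z z + 2 * q0.
    have := dotp_le2 (z - z0) z.
    rewrite (_ : z - z0 - z = - z0); last by rewrite addrAC subrr add0r.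
    by rewrite dotpN -/q0 -/(E z) addrC.
  move/le_trans; apply.
  rewrite addrC /c [leRHS]mulrDl lerD//.
    by rewrite mulrA ler_pM2r// mulrAC ler_pdivlMr// ler_pM2l.
  rewrite le_eqVlt; apply/orP; left; apply/eqP; field.
  by rewrite gt_eqF.
- move=> t tb.
  have tbd : box t0 d t by move=> k; apply: lt_le_trans (tb k) _; rewrite /d' ge_min lexx.
  have Ft : F i (rowt t) != 0 by apply: contraTneq (posS t tbd) => ->; rewrite mulr0 ltxx.
  rewrite tauE// lerD2l lerN2.
  have Em : E (rowt t - b) <= m.
    apply: le_trans d'm; rewrite mulr_natl -[X in _ *+ X]card_ord -sumr_const.
    apply: ler_sum => k _; rewrite -expr2 -real_normK ?num_real//.
    rewrite lerXn2r ?nnegrE ?(ltW d'_gt0)//; apply/ltW; have := tb k.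
    by rewrite !mxE tnth_mktuple opprB addrA subrK.
  set z := rowt t - b in Em *.
  have zq : q0 <= 2 * E z + 2 * dotp z z.
    have := dotp_le2 z0 z; rewrite -(dotpN (z0 - z)) opprB; exact.
  have m1 : m <= q0 / 4 by rewrite /m ge_min lexx.
  have m2 : m <= eta * q0 ^+ 2 / 8 by rewrite /m ge_min lexx orbT.
  have qz4 : q0 / 4 <= dotp z z by lra.
  have qz_gt0 : 0 < dotp z z by apply: lt_le_trans qz4; lra.
  rewrite ler_pdivrMr; last exact: mulr_gt0.
  apply: (le_trans Em); apply: (le_trans m2).
  rewrite (_ : eta * q0 ^+ 2 / 8 = eta / 2 * (q0 / 4 * q0)); last by field.
  by rewrite ler_pM2l ?divr_gt0// ler_pM2r.
- move=> t tb /phiF Ft; rewrite tauE// lerD2l lerN2.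
  have zr := Ffar _ Ft.
  have Ed : d ^+ 2 <= E (rowt t - b).
    have [k /negP] : exists k, ~ `|tnth t k - tnth t0 k| < d by exact/existsNP.
    rewrite -leNgt tnth_mktuple => dk; rewrite /E /dotp (bigD1 k)//=.
    apply: (@le_trans _ _ ((tnth t k - y0 0 k) ^+ 2)).
      by rewrite -[leRHS]real_normK ?num_real// lerXn2r ?nnegrE// ltW.
    rewrite !mxE opprB addrA subrK expr2 lerDl.
    by apply: sumr_ge0 => l _; rewrite -expr2 sqr_ge0.
  set z := rowt t - b in zr Ed *.
  have qz_gt0 : 0 < dotp z z by rewrite -nrm_sqr exprn_gt0// (lt_le_trans r_gt0).
  have zq : dotp z z <= 2 * E z + 2 * q0 by exact: dotp_le2.
  rewrite ler_pdivlMr; last exact: mulr_gt0.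
  rewrite /eta [X^-1 * _]mulrC ler_pdivrMr//.
  rewrite (_ : E z * X = (2 * E z + 2 * q0 / d ^+ 2 * E z) * q0); last by rewrite /X; ring.
  rewrite ler_pM2r// (le_trans zq)// lerD2l -mulrA.
  by rewrite ler_peMr ?mulr_ge0 ?(ltW q0_gt0)// mulrC ler_pdivlMr ?exprn_gt0// mul1r.
- move=> N.
  have := annihilates1E
    (annihilates1_kpeak a_ge0 r_gt0 intF F_eq0 (c - q0^-1) v N 0 a_gt0 Hr) bb.
  move=> /(congr1 (fun x => sg * x)); rewrite mulr0 -RintegralZl//; last first.
    exact: (integrable_term a_ge0 r_gt0 intF F_eq0).
  move=> <-; apply: eq_Rintegral => t _.
  rewrite keval_iter /phi -/(tau t).
  rewrite -[keval a (kmonomial v 0 2) _]/(keval a (kradial R n 2) _).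
  by rewrite -mulrA -[F i _ * _ * _]mulrA [keval _ _ _ * _]mulrC.
Qed.

End vanishing.

(** * Polar coordinates *)

Section polar.
Context (R : realType) (n : nat).
Notation RR := (measurableTypeR R).
Notation TT := (n.-tuple RR).
Notation leb := (@lebesgue_measure R).
Notation lam := (lebesgue_tuple R n).
Local Open Scope ereal_scope.

Lemma ge0_integral_mrestr d (T : measurableType d) (mu : {measure set T -> \bar R})
    (D : set T) (mD : measurable D) (g : T -> \bar R) :
  measurable_fun setT g -> (forall t, 0 <= g t) ->
  \int[mrestr mu mD]_t g t = \int[mu]_(t in D) g t.
Proof.
move=> mg g0.
rewrite (@ge0_negligible_integral _ _ _ (mrestr mu mD) setT (~` D))//; last 2 first.
- exact: measurableC.
- by rewrite /= /mrestr setICl measure0.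
rewrite setTD setCK; apply: eq_measure_integral => A mA AD.
by rewrite /= /mrestr setIidl.
Qed.

(** The surface measure is [n] times the image of Lebesgue measure on the punctured ball under
    normalization, and normalized points lie on the sphere. *)
Lemma ge0_integral_sphere (g : TT -> \bar R) :
  measurable_fun setT g -> (forall t, 0 <= g t) ->
  \int[@sphere_measure R n]_(t in @unit_sphere R n) g t =
  n%:R%:E * \int[lam]_(t in @punctured_ball R n) g (tnormalize t).
Proof.
move=> mg g0.
have mS : measurable (@unit_sphere R n).
  rewrite (_ : @unit_sphere R n = @tnorm R n @^-1` [set 1%R])//.
  by rewrite -[X in measurable X]setTI; exact: measurable_tnorm.
have mN := @measurable_tnormalize R n.
pose P : {measure set TT -> \bar R} :=
  measure_function_pushforward__canonical__measure_function_Measure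
    (mrestr lam (@measurable_punctured_ball R n)) mN.
rewrite (eq_measure_integral (mscale (NngNum (ler0n R n)) P)); last first.
  by move=> A mA _; rewrite /= /mscale /= /pushforward /mrestr /sphere_measure setIC.
rewrite ge0_integral_mscale//; last exact: measurable_funTS.
congr (_ * _).
rewrite ge0_integral_pushforward//; last exact: measurable_funTS.
rewrite integral_mkcond ge0_integral_mrestr; last 2 first.
- apply/(measurable_restrictT _ _).1.
    by rewrite -[X in measurable X]setTI; exact: (@measurable_tnormalize R n).
  by apply: measurable_funTS; exact: measurableT_comp.
- by move=> t; rewrite patchE; case: ifP => //= _; exact: g0.
apply: eq_integral => t /set_mem /= /andP[t0 _].
rewrite patchE mem_set// /preimage /unit_sphere /= /tnorm.
under eq_bigr do rewrite tnth_mktuple exprMn.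
rewrite -mulr_sumr sqrtrM ?sqr_ge0// sqrtr_sqr normfV -/(tnorm t).
by rewrite gtr0_norm// mulVf// gt_eqF.
Qed.

Definition tscale (u : R) (t : TT) : TT := [tuple (u * tnth t i)%R | i < n].

Lemma tscaleE u t : tscale u t = taff u [tuple 0%R | i < n] t.
Proof. by apply: eq_from_tnth => i; rewrite !tnth_mktuple addr0. Qed.

Lemma tscaleM u v t : tscale u (tscale v t) = tscale (u * v)%R t.
Proof. by apply: eq_from_tnth => i; rewrite !tnth_mktuple mulrA. Qed.

Lemma tscale1 t : tscale 1 t = t.
Proof. by apply: eq_from_tnth => i; rewrite tnth_mktuple mul1r. Qed.

Lemma tnorm_tscale u t : (0 <= u)%R -> tnorm (tscale u t) = (u * tnorm t)%R.
Proof.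
move=> u0; rewrite /tnorm; under eq_bigr do rewrite tnth_mktuple exprMn.
by rewrite -mulr_sumr sqrtrM ?sqr_ge0// sqrtr_sqr ger0_norm.
Qed.

Lemma measurable_tscale d (T : measurableType d) (u : T -> RR) (g : T -> TT) :
  measurable_fun setT u -> measurable_fun setT g ->
  measurable_fun setT (fun x => tscale (u x) (g x)).
Proof.
move=> mu mg; apply/measurable_fun_tnthP => i.
rewrite (_ : _ \o _ = (fun x => u x * tnth (g x) i)%R); last first.
  by apply/funext => x /=; rewrite tnth_mktuple.
apply: measurable_funM => //.
exact: (measurableT_comp (measurable_tnth i) mg).
Qed.

Lemma ge0_integral_tscale u (g : TT -> \bar R) :
  (0 < u)%R -> measurable_fun setT g -> (forall x, 0 <= g x) ->
  \int[lam]_t g (tscale u t) = (u ^- n)%:E * \int[lam]_t g t.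
Proof.
move=> u0 mg g0; rewrite -(ge0_integral_taff [tuple 0%R | i < n] u0)//.
by apply: eq_integral => t _; rewrite tscaleE.
Qed.

Lemma ge0_integral_scale0y (c : R) (g : RR -> \bar R) : (0 < c)%R ->
  measurable_fun setT g -> (forall x, (0 < x)%R -> 0 <= g x) ->
  \int[leb]_(x in `]0%R, +oo[) g x = c%:E * \int[leb]_(x in `]0%R, +oo[) g (c * x)%R.
Proof.
move=> c0 mg g0.
pose G := g \_ (`]0%R, +oo[%classic : set R).
have mG : measurable_fun setT G.
  by apply/(measurable_restrictT _ _).1 => //; exact: measurable_funTS.
have G0 x : 0 <= G x.
  by rewrite /G patchE; case: ifP => // /set_mem /=; rewrite in_itv /= andbT => /g0.
rewrite integral_mkcond -/G [in RHS]integral_mkcond.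
transitivity (c%:E * \int[leb]_x G (c * x + 0)%R).
  by rewrite ge0_integral_affine// muleA -EFinM divff ?gt_eqF// mul1e.
congr (_ * _); apply: eq_integral => x _.
rewrite /G !patchE addr0 !mem_setE !in_itv /= !andbT.
by rewrite pmulr_rgt0.
Qed.

(** The antiderivative is -u^(-n)/n. The value cancels the factor [n] of the surface measure; the
    case [n = 1] also bounds the tail of the Gamma integral. *)
Lemma integral_tail_powR p : (0 < n)%N -> (0 < p)%R ->
  \int[leb]_(u in `[p, +oo[) (u `^ (- n.+1%:R))%:E = (p ^- n / n%:R)%:E.
Proof.
move=> n0 p0; have nR : (n%:R != 0 :> R)%R by rewrite pnatr_eq0 -lt0n.
pose G (u : R) := (- n%:R^-1 * u `^ (- n%:R))%R.
have dG (u : R) : (0 < u)%R -> is_derive u 1%R G (u `^ (- n.+1%:R))%R.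
  move=> u0; have := is_deriveZ (- n%:R^-1)%R (is_derive1_powR (- n%:R) u0).
  move=> H; apply: is_derive_eq.
  rewrite /GRing.scale /= mulrA mulrNN mulVf// mul1r; congr (_ `^ _)%R.
  by rewrite -[in RHS]natr1 opprD.
have cG (u : R) : (0 < u)%R -> {for u, continuous G}.
  move=> u0; apply: differentiable_continuous; apply/derivable1_diffP.
  by have /@ex_derive := dG u u0.
have cg (u : R) : (0 < u)%R -> {for u, continuous (fun u : R => (u `^ (- n.+1%:R))%R)}.
  move=> u0; apply: differentiable_continuous; apply/derivable1_diffP.
  by have /@ex_derive := is_derive1_powR (- n.+1%:R)%R u0.
have Goo : G u @[u --> +oo%R] --> (0 : R)%R.
  rewrite -[X in _ --> X](mulr0 (- n%:R^-1)%R); apply: cvgM; first exact: cvg_cst.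
  have Voo : (u^-1)%R @[u --> +oo%R] --> (0 : R)%R.
    apply/gtr0_cvgV0; last exact: cvg_id.
    by near=> u; near: u; exact: nbhs_pinfty_gt.
  apply: (@squeeze_cvgr _ _ _ _ (cst 0%R) (fun u : R => u^-1%R)) => //; last exact: cvg_cst.
  near=> u; rewrite /= powR_ge0 /=.
  have u1 : (1 <= u)%R by near: u; apply: nbhs_pinfty_ge; rewrite num_real.
  have u0 : (0 < u)%R by exact: lt_le_trans u1.
  rewrite powRN powR_mulrn ?(ltW u0)// lef_pV2 ?posrE ?exprn_gt0//.
  by rewrite -{1}[u]expr1 ler_weXn2l.
rewrite (@ge0_continuous_FTC2y R (fun u => u `^ (- n.+1%:R))%R G p 0%R).
- rewrite sub0e -EFinN /G mulNr opprK powRN powR_mulrn ?(ltW p0)// mulrC.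
  by [].
- by move=> u _; exact: powR_ge0.
- apply: continuous_in_subspaceT => u /set_mem /=.
  by rewrite in_itv /= andbT => pu; apply: cg; exact: lt_le_trans pu.
- exact: Goo.
- by move=> u pu; have /@ex_derive := dG u (lt_trans p0 pu).
- by apply: cvg_at_right_filter; exact: cG.
- move=> u; rewrite in_itv /= andbT => pu.
  by rewrite derive1E; have /@derive_val := dG u (lt_trans p0 pu).
Unshelve. all: by end_near. Qed.

Definition ray_integral (h : TT -> \bar R) (t : TT) : \bar R :=
  \int[leb]_(u in `]0%R, +oo[) ((u ^+ n.-1)%:E * h (tscale u t)).

Section ray_integrand.
Variable h : TT -> \bar R.
Hypothesis mh : measurable_fun setT h.
Hypothesis h0 : forall t, 0 <= h t.

(** Extended by zero to all real radii, so that Tonelli applies on the full product. *)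
Definition ray_integrand (p : TT * RR) : \bar R :=
  ((p.2 ^+ n.-1)%:E * h (tscale p.2 p.1)) * (\1_(`]0%R, +oo[%classic : set R) p.2)%:E.

Lemma measurable_ray_integrand : measurable_fun setT ray_integrand.
Proof.
apply: emeasurable_funM.
  apply: emeasurable_funM.
    by apply/measurable_EFinP; apply: measurable_funX; exact: measurable_snd.
  by apply: (measurableT_comp mh); exact: measurable_tscale.
have mD : measurable_fun setT (\1_(`]0%R, +oo[%classic : set R) : RR -> R).
  by apply: measurable_indic; exact: measurable_itv.
by apply/measurable_EFinP; exact: (measurableT_comp mD measurable_snd).
Qed.

Lemma ray_integrand_ge0 p : 0 <= ray_integrand p.
Proof.
rewrite /ray_integrand indicE; case: (boolP (p.2 \in _)) => [/set_mem|_] /=.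
  rewrite in_itv /= andbT => p0.
  by rewrite mule1 mule_ge0// lee_fin exprn_ge0// ltW.
by rewrite mule0.
Qed.

Lemma ray_integralE t : ray_integral h t = \int[leb]_u ray_integrand (t, u).
Proof.
rewrite /ray_integral integral_mkcond; apply: eq_integral => u _.
by rewrite patchE /ray_integrand /= indicE; case: ifP => _; rewrite ?mule1 ?mule0.
Qed.

Lemma measurable_ray_integral : measurable_fun setT (ray_integral h).
Proof.
rewrite (_ : ray_integral h = fun t => \int[leb]_u ray_integrand (t, u)); last first.
  by apply/funext => t; exact: ray_integralE.
exact: (@measurable_fun_fubini_tonelli_F _ _ _ _ _ leb ray_integrand
  measurable_ray_integrand ray_integrand_ge0).
Qed.

Lemma ray_integral_ge0 t : 0 <= ray_integral h t.
Proof. by rewrite ray_integralE; apply: integral_ge0 => u _; exact: ray_integrand_ge0. Qed.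

End ray_integrand.

(** By definition the left side averages over directions t/|t| with t in the ball. Rescaling the
    radius by |t| leaves n times the integral of |t|^n u^(n-1) h(ut) over the ball and all u > 0.
    For fixed u, put y = ut: the weight becomes |y|^n u^(-n-1) on |y| <= u, and integrating over u
    gives 1/n. *)
Lemma polar_ge0 (h : TT -> \bar R) : (0 < n)%N ->
  measurable_fun setT h -> (forall t, 0 <= h t) -> (forall t, tnorm t = 0%R -> h t = 0) ->
  \int[@sphere_measure R n]_(t in @unit_sphere R n) ray_integral h t =
  \int[lam]_t h t.
Proof.
move=> n0 mh h0 hz.
have mtn : measurable_fun setT (@tnorm R n) by exact: measurable_tnorm.
have mPB : measurable (@punctured_ball R n) by exact: measurable_punctured_ball.
pose D : set R := `]0%R, +oo[%classic.
pose f := ray_integrand h.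
have mf : measurable_fun setT f by exact: measurable_ray_integrand.
have f0 p : 0 <= f p by exact: ray_integrand_ge0.
pose J := ray_integral h.
have JE t : \int[leb]_u f (t, u) = J t by rewrite -ray_integralE.
have mJ : measurable_fun setT J by exact: measurable_ray_integral.
have J0 t : 0 <= J t by exact: ray_integral_ge0.
rewrite ge0_integral_sphere//.
transitivity (n%:R%:E * \int[lam]_(t in @punctured_ball R n) ((tnorm t ^+ n)%:E * J t)).
  congr (_ * _); apply: eq_integral => t /set_mem /andP[t0 _].
  rewrite /J /ray_integral (ge0_integral_scale0y t0); last 2 first.
  - apply: emeasurable_funM; first by apply/measurable_EFinP; exact: measurable_funX.
    apply: (measurableT_comp mh).
    exact: measurable_tscale.
  - move=> u u0; rewrite mule_ge0// lee_fin exprn_ge0//; exact: ltW.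
  have -> : (tnorm t ^+ n = tnorm t * tnorm t ^+ n.-1)%R by rewrite -exprS prednK.
  rewrite EFinM -muleA; congr (_ * _); rewrite -ge0_integralZl//.
  - apply: eq_integral => u _.
    rewrite exprMn EFinM -!muleA; congr (_ * (_ * h _)).
    apply: eq_from_tnth => i; rewrite !tnth_mktuple mulrA; congr (_ * _)%R.
    by rewrite mulrAC divff ?mul1r// gt_eqF.
  - apply: measurable_funTS; apply: emeasurable_funM.
      by apply/measurable_EFinP; exact: measurable_funX.
    by apply: (measurableT_comp mh); exact: measurable_tscale.
  - move=> u /=; rewrite in_itv /= andbT => u0.
    by rewrite mule_ge0// lee_fin exprn_ge0// ltW.
  - by rewrite lee_fin exprn_ge0// ltW.
pose PB := @punctured_ball R n.
pose f1 (p : TT * RR) := (\1_PB p.1 * tnorm p.1 ^+ n)%:E * f p.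
have mind (A : set TT) : measurable A -> measurable_fun setT (fun p : TT * RR => (\1_A p.1 : R)).
  move=> mA; have mA1 : measurable_fun setT (\1_A : TT -> R) by exact: measurable_indic.
  exact: (measurableT_comp mA1 measurable_fst).
have mtn1 : measurable_fun setT (fun p : TT * RR => tnorm p.1).
  exact: (measurableT_comp mtn measurable_fst).
have mf1 : measurable_fun setT f1.
  apply: emeasurable_funM => //; apply/measurable_EFinP; apply: measurable_funM.
    exact: mind.
  exact: measurable_funX.
have tn0 (t : TT) : (0 <= tnorm t)%R by exact: sqrtr_ge0.
have f10 p : 0 <= f1 p by rewrite mule_ge0// lee_fin mulr_ge0// exprn_ge0.
transitivity (n%:R%:E * \int[lam]_t \int[leb]_u f1 (t, u)).
  congr (_ * _); rewrite integral_mkcond; apply: eq_integral => t _.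
  transitivity ((\1_PB t * tnorm t ^+ n)%:E * J t).
    by rewrite patchE indicE -/PB; case: ifP => _; rewrite ?mul1r// mul0r mul0e.
  rewrite -JE -ge0_integralZl//.
  - exact: (measurableT_comp mf (measurable_pair1 t)).
  - by rewrite lee_fin mulr_ge0// exprn_ge0.
rewrite (fubini_tonelli f1)//.
(* The constraint 0 < |t| <= 1 after the substitution t = y/u. *)
pose Q : set (TT * RR) := [set p | (0 < tnorm p.1 <= p.2)%R].
have mQ : measurable Q.
  rewrite (_ : Q = [set p | (0 < tnorm p.1)%R] `&` [set p | (tnorm p.1 <= p.2)%R]); last first.
    by apply/seteqP; split => p /= => [/andP[? ?]|[? ?]]; [split|apply/andP].
  apply: measurableI; rewrite -[X in measurable X]setTI.
    by apply: measurable_fun_ltr => //; exact: measurable_cst.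
  by apply: measurable_fun_ler => //; exact: measurable_snd.
pose f2 (p : TT * RR) := (\1_Q p * (tnorm p.1 ^+ n * p.2 `^ (- n.+1%:R)))%:E * h p.1.
have mf2 : measurable_fun setT f2.
  apply: emeasurable_funM; last exact: (measurableT_comp mh measurable_fst).
  apply/measurable_EFinP; apply: measurable_funM; first exact: measurable_indic.
  apply: measurable_funM; first exact: measurable_funX.
  exact: (measurableT_comp (measurable_powR _) measurable_snd).
have f20 p : 0 <= f2 p.
  by rewrite mule_ge0// lee_fin !mulr_ge0 ?powR_ge0// exprn_ge0.
transitivity (n%:R%:E * \int[leb]_u \int[lam]_t f2 (t, u)).
  congr (_ * _); apply: eq_integral => u _.
  have [u0|u0] := ltP 0%R u; last first.
    rewrite !integral0_eq// => t _.
      rewrite /f2 indicE memNset ?mul0r ?mul0e// /Q /= => /andP[t0 tu].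
      by have := lt_le_trans t0 tu; rewrite ltNge u0.
    rewrite /f1 /f /ray_integrand /= -/D [\1_D u]indicE memNset ?mule0//.
    by rewrite /D /= in_itv /= andbT; apply/negP; rewrite -leNgt.
  pose g (y : TT) := f1 (tscale u^-1 y, u).
  have mg : measurable_fun setT g.
    apply: (measurableT_comp mf1); apply/measurable_fun_pairP; split.
      exact: (@measurable_tscale _ _ (cst u^-1%R) id).
    exact: measurable_cst.
  transitivity (\int[lam]_t g (tscale u t)).
    by apply: eq_integral => t _; rewrite /g tscaleM mulVf ?tscale1// gt_eqF.
  have g0 y : 0 <= g y by exact: f10.
  rewrite ge0_integral_tscale//.
  transitivity (\int[lam]_y ((u ^- n)%:E * g y)).
    by rewrite ge0_integralZl// lee_fin invr_ge0 exprn_ge0// ltW.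
  apply: eq_integral => y _.
  rewrite /g /f1 /f2 /f /ray_integrand /= tscaleM divff ?gt_eqF// tscale1 tnorm_tscale ?invr_ge0 ?(ltW u0)//.
  rewrite -/D; have -> : \1_D u = 1%R :> R by rewrite indicE mem_set// /D /= in_itv /= u0.
  have -> : \1_PB (tscale u^-1 y) = \1_Q (y, u) :> R.
    have E : PB (tscale u^-1 y) = Q (y, u).
      rewrite /PB /punctured_ball /Q /= tnorm_tscale ?invr_ge0 ?(ltW u0)//.
      by rewrite pmulr_rgt0 ?invr_gt0// mulrC ler_pdivrMr// mul1r.
    by rewrite !indicE; congr (nat_of_bool _)%:R%R; apply/idP/idP => /set_mem; rewrite ?E => H;
      apply/mem_set; rewrite ?E.
  rewrite mule1 !muleA -!EFinM; congr (_%:E * _).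
  rewrite powRN powR_mulrn ?(ltW u0)// exprMn exprVn [(u ^+ n.+1)%R]exprS.
  have -> : (u ^+ n = u * u ^+ n.-1)%R by rewrite -exprS prednK.
  have a0 : (u ^+ n.-1 != 0)%R by rewrite expf_neq0// gt_eqF.
  have u1 : (u != 0)%R by rewrite gt_eqF.
  by field; rewrite u1 a0.
rewrite -(fubini_tonelli f2)// -ge0_integralZl//; last 2 first.
- exact: (@measurable_fun_fubini_tonelli_F _ _ _ _ _ leb f2 mf2 f20).
- by move=> t _; exact: integral_ge0.
apply: eq_integral => y _.
(* At the origin both sides vanish by [hz], which saves an argument with null sets. *)
have [y0|y0] := ltP 0%R (tnorm y); last first.
  have yz : tnorm y = 0%R by apply/eqP; rewrite eq_le y0 tn0.
  rewrite (hz _ yz) integral0_eq ?mule0// => u _.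
  by rewrite /f2 /= (hz _ yz) mule0.
transitivity (n%:R%:E * ((tnorm y ^+ n)%:E * h y *
    \int[leb]_(u in `[tnorm y, +oo[) (u `^ (- n.+1%:R))%:E)).
  congr (_ * _); rewrite [in RHS]integral_mkcond -ge0_integralZl//.
  - apply: eq_integral => u _; rewrite patchE /f2 indicE /=.
    have E : ((y, u) \in Q) = (u \in (`[tnorm y, +oo[%classic : set R)).
      by apply/idP/idP => /set_mem H; apply/mem_set; move: H; rewrite /Q /= in_itv /= andbT y0.
    rewrite E; case: ifP => _; last by rewrite mul0r mul0e mule0.
    by rewrite mul1r EFinM muleAC.
  - apply/(measurable_restrictT _ _).1; first exact: measurable_itv.
    by apply/measurable_EFinP; apply: measurable_funTS; exact: measurable_powR.
  - by move=> u _; rewrite patchE; case: ifP => // _; rewrite lee_fin powR_ge0.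
  - by rewrite mule_ge0// lee_fin exprn_ge0.
rewrite integral_tail_powR// muleAC -EFinM muleA -EFinM.
rewrite (_ : (_ * _)%R = 1%R) ?mul1e//.
have ny : (tnorm y != 0)%R by rewrite gt_eqF.
by field; rewrite ?ny ?pnatr_eq0 -?lt0n ?n0 ?expf_neq0.
Qed.

End polar.

(** * Polar coordinates for signed integrands *)

Section polar_signed.
Context (R : realType) (n : nat).
Notation RR := (measurableTypeR R).
Notation TT := (n.-tuple RR).
Notation leb := (@lebesgue_measure R).
Notation lam := (lebesgue_tuple R n).
Local Notation D := (`]0, +oo[%classic : set R).

Lemma ray_integral_posneg (k : TT -> R) t :
  (\int[leb]_(u in D) (u ^+ n.-1 * k (tscale u t))%:E =
   ray_integral (EFin \o k)^\+ t - ray_integral (EFin \o k)^\- t)%E.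
Proof.
rewrite integralE; congr (_ - _)%E; apply: eq_integral => u /set_mem /=;
  rewrite in_itv /= andbT => u0; rewrite !(funeposE, funenegE) /=.
- rewrite -[LHS]/(maxe ((u ^+ n.-1)%:E * (k (tscale u t))%:E) 0)%E.
  by rewrite maxe_pMr ?mule0// lee_fin exprn_ge0// ltW.
- rewrite -[LHS]/(maxe (- ((u ^+ n.-1)%:E * (k (tscale u t))%:E)) 0)%E.
  by rewrite -muleN maxe_pMr ?mule0// lee_fin exprn_ge0// ltW.
Qed.

(** The weight [w] is constant along rays, so it enters the inner integral; [polar_ge0] then applies
    to the positive and negative parts of [w h]. *)
Lemma polar_Rintegral (h w : TT -> R) : (0 < n)%N ->
  measurable_fun setT h -> measurable_fun setT w ->
  lam.-integrable setT (EFin \o h) -> (forall t, tnorm t = 0 -> h t = 0) ->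
  (forall t, `|w t| <= 1) -> (forall u t, 0 < u -> w (tscale u t) = w t) ->
  \int[@sphere_measure R n]_(t in @unit_sphere R n)
    (w t * \int[leb]_(u in D) (u ^+ n.-1 * h (tscale u t))) =
  \int[lam]_t (w t * h t).
Proof.
move=> n0 mh mw ih hz w1 wD.
pose S := @unit_sphere R n.
have mS : measurable S.
  rewrite (_ : S = @tnorm R n @^-1` [set 1])//.
  by rewrite -[X in measurable X]setTI; exact: measurable_tnorm.
pose k t := w t * h t.
have mk : measurable_fun setT (EFin \o k).
  by apply/measurable_EFinP; exact: measurable_funM.
have kh t : `|k t| <= `|h t| by rewrite normrM ler_piMl.
have ik : lam.-integrable setT (EFin \o k).
  apply: (@le_integrable _ _ _ lam setT measurableT _ (EFin \o h)) => //.
  by move=> t _; rewrite !abse_EFin lee_fin.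
have kz t : tnorm t = 0 -> k t = 0 by move=> t0; rewrite /k hz// mulr0.
have mE : measurable_fun setT (EFin \o h) by exact/measurable_EFinP.
(* The variable [s] stands for either part, so that one proof serves both signs. *)
have polar_int (g : TT -> R) (s : (TT -> \bar R) -> TT -> \bar R) :
    (s = @funepos TT R \/ s = @funeneg TT R) -> measurable_fun setT (EFin \o g) ->
    lam.-integrable setT (EFin \o g) -> (forall t, tnorm t = 0 -> g t = 0) ->
    (\int[@sphere_measure R n]_(t in S) ray_integral (s (EFin \o g)) t =
      \int[lam]_t s (EFin \o g) t)%E /\
    (@sphere_measure R n).-integrable S (ray_integral (s (EFin \o g))).
  move=> sE mg ig gz.
  have ms : measurable_fun setT (s (EFin \o g)).
    by case: sE => ->; [exact: measurable_funepos|exact: measurable_funeneg].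
  have s0 t : (0 <= s (EFin \o g) t)%E by case: sE => ->.
  have sz t : tnorm t = 0 -> s (EFin \o g) t = 0%E.
    by move=> t0; case: sE => ->; rewrite ?funeposE ?funenegE /= (gz _ t0) ?oppr0 maxxx.
  have is_ : lam.-integrable setT (s (EFin \o g)).
    by case: sE => ->; [exact: integrable_funepos|exact: integrable_funeneg].
  have P := polar_ge0 n0 ms s0 sz; split => //.
  apply/integrableP; split.
    by apply: measurable_funTS; exact: measurable_ray_integral.
  under eq_integral do rewrite gee0_abs ?ray_integral_ge0//.
  by rewrite P; exact: (integrable_lty measurableT is_).
have [Pp Ip] := polar_int k _ (or_introl erefl) mk ik kz.
have [Pm Im] := polar_int k _ (or_intror erefl) mk ik kz.
have [_ Hp] := polar_int h _ (or_introl erefl) mE ih hz.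
have [_ Hm] := polar_int h _ (or_intror erefl) mE ih hz.
rewrite /Rintegral; congr fine.
transitivity (\int[@sphere_measure R n]_(t in S)
   (ray_integral (EFin \o k)^\+ t - ray_integral (EFin \o k)^\- t))%E; last first.
  by rewrite integralB// Pp Pm -integralE.
apply: ae_eq_integral => //.
- apply/measurable_EFinP; apply: measurable_funM; first exact: measurable_funTS.
  under eq_fun do rewrite ray_integral_posneg.
  apply: measurableT_comp => //; apply: emeasurable_funB; apply: measurable_funTS;
    apply: measurable_ray_integral => //; [exact: measurable_funepos|exact: measurable_funeneg].
- by apply: emeasurable_funB; apply: measurable_funTS;
    apply: measurable_ray_integral => //; [exact: measurable_funepos|exact: measurable_funeneg].
(* [w t] can be moved inside only where the ray integral converges. This holds in almost every
   direction, because the ray integrals of both parts of [h] are integrable on the sphere. *)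
have := integrable_ae mS Hp; have := integrable_ae mS Hm.
apply: filterS2 => t Fm Fp St; have {}Fm := Fm St; have {}Fp := Fp St.
have mts : measurable_fun setT (fun u : RR => tscale u t).
  have := (measurable_tscale (@measurable_id _ RR setT) (@measurable_cst _ _ RR TT setT t)).
  exact.
have mray : measurable_fun D (fun u : RR => (u ^+ n.-1 * h (tscale u t))).
  apply: measurable_funTS; apply: measurable_funM; first exact: measurable_funX.
  by apply: (measurableT_comp mh); exact: mts.
have iray : leb.-integrable D (EFin \o (fun u : RR => u ^+ n.-1 * h (tscale u t))).
  apply/integrableP; split; first exact/measurable_EFinP.
  rewrite (eq_integral (fun u : RR => (u ^+ n.-1)%:E * (EFin \o h)^\+ (tscale u t) +
      (u ^+ n.-1)%:E * (EFin \o h)^\- (tscale u t))%E); last first.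
    move=> u /set_mem /=; rewrite in_itv /= andbT => u0.
    rewrite -ge0_muleDr// -[RHS]/(_ * ((EFin \o h)^\+ \+ (EFin \o h)^\-) _)%E.
    by rewrite -fune_abse /= normrM ger0_norm// exprn_ge0// ltW.
  have mpart (g : TT -> \bar R) : measurable_fun setT g ->
      measurable_fun D (fun u : RR => (u ^+ n.-1)%:E * g (tscale u t))%E.
    move=> mg; apply: measurable_funTS; apply: emeasurable_funM.
      by apply/measurable_EFinP; exact: measurable_funX.
    by apply: (measurableT_comp mg); exact: mts.
  have ge0part (g : TT -> \bar R) : (forall t, 0 <= g t)%E ->
      forall u, D u -> (0 <= (u ^+ n.-1)%:E * g (tscale u t))%E.
    move=> g0 u /=; rewrite in_itv /= andbT => u0.
    by rewrite mule_ge0// lee_fin exprn_ge0// ltW.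
  rewrite ge0_integralD//.
  - by rewrite -!/(ray_integral _ t) lte_add_pinfty// -ge0_fin_numE ?Fp ?Fm//;
      apply: ray_integral_ge0.
  - exact: ge0part.
  - by apply: mpart; exact: measurable_funepos.
  - exact: ge0part.
  - by apply: mpart; exact: measurable_funeneg.
rewrite -RintegralZl//.
rewrite (@eq_Rintegral _ _ _ leb D (fun u => u ^+ n.-1 * k (tscale u t))); last first.
  move=> u /set_mem /=; rewrite in_itv /= andbT => u0.
  by rewrite /k wD// mulrCA.
have mD : measurable (D : set RR) by exact: measurable_itv.
rewrite -ray_integral_posneg /Rintegral fineK//; apply: integrable_fin_num => //.
have := integrableZl mD (w t) iray.
have E : {in D, (fun u : RR => (w t)%:E * (u ^+ n.-1 * h (tscale u t))%:E)%E =1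
    (fun u : RR => (u ^+ n.-1 * k (tscale u t))%:E)}.
  move=> u; rewrite inE /= in_itv /= andbT => u0; rewrite /k wD// mulrCA EFinM.
  by [].
exact: (@eq_integrable _ _ R leb D mD _ _ E).
Qed.

End polar_signed.

(** * The Gamma function *)

Section Gamma.
Context (R : realType).
Notation leb := (@lebesgue_measure R).

(** On each interval [1/(k+2), 1] the antiderivative t^x / x bounds the integral by 1/x; monotone
    convergence passes to the limit. *)
Lemma integral_powR_itv01_lty (x : R) : 0 < x ->
  (\int[leb]_(t in `]0%R, 1%R]) (t `^ (x - 1))%:E < +oo)%E.
Proof.
move=> x0.
pose E k : set R := `[k.+2%:R^-1, 1]%classic.
have EU : `]0, 1]%classic = \bigcup_k E k :> set R.
  apply/seteqP; split => t /=.
    rewrite in_itv /= => /andP[t0 t1].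
    have [k _ /(_ _ (leqnn _)) kt] := near_infty_natSinv_lt (PosNum t0).
    exists k => //; rewrite /E /= in_itv /= t1 andbT; apply/ltW/(le_lt_trans _ kt).
    by rewrite lef_pV2 ?posrE// ler_nat.
  move=> [k _]; rewrite /E /= !in_itv /= => /andP[kt ->]; rewrite andbT.
  by apply: lt_le_trans kt; rewrite invr_gt0.
rewrite EU.
have mp : measurable_fun setT (fun t : R => (t `^ (x - 1))%:E).
  by apply/measurable_EFinP; exact: measurable_powR.
have bound k : (\int[leb]_(t in E k) (t `^ (x - 1))%:E <= (x^-1)%:E)%E.
  pose G (u : R) := x^-1 * u `^ x.
  have dG (u : R) : 0 < u -> is_derive u 1 G (u `^ (x - 1)).
    move=> u0; have := is_deriveZ x^-1 (is_derive1_powR x u0).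
    move=> H; apply: is_derive_eq.
    by rewrite /GRing.scale /= mulrA mulVf ?mul1r// gt_eqF.
  have cG (u : R) : 0 < u -> {for u, continuous G}.
    move=> u0; apply: differentiable_continuous; apply/derivable1_diffP.
    by have /@ex_derive := dG u u0.
  have cg (u : R) : 0 < u -> {for u, continuous (fun u : R => u `^ (x - 1))}.
    move=> u0; apply: differentiable_continuous; apply/derivable1_diffP.
    by have /@ex_derive := is_derive1_powR (x - 1) u0.
  have k0 : (0 : R) < k.+2%:R^-1 by rewrite invr_gt0.
  have k1 : (k.+2%:R^-1 : R) < 1 by rewrite invf_lt1// ltr1n.
  rewrite /E (@continuous_FTC2 R _ G)//.
  - rewrite -EFinB lee_fin /G powR1 mulr1 gerBl mulr_ge0 ?powR_ge0// invr_ge0 ltW//.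
  - apply: continuous_in_subspaceT => u /set_mem /=.
    by rewrite in_itv /= => /andP[ku _]; apply: cg; exact: lt_le_trans ku.
  - split.
    + move=> u; rewrite in_itv /= => /andP[ku _].
      by have /@ex_derive := dG u (lt_trans k0 ku).
    + by apply: cvg_at_right_filter; exact: cG.
    + by apply: cvg_at_left_filter; exact: cG.
  - move=> u; rewrite in_itv /= => /andP[ku _].
    by rewrite derive1E; have /@derive_val := dG u (lt_trans k0 ku).
have cvgE : (\int[leb]_(t in E k) (t `^ (x - 1))%:E @[k --> \oo] -->
    \int[leb]_(t in \bigcup_k E k) (t `^ (x - 1))%:E)%E.
  apply: ge0_nondecreasing_set_cvg_integral.
  - move=> i j ij; apply/subsetPset => t; rewrite /E /= !in_itv /= => /andP[it ->].
    by rewrite andbT (le_trans _ it)// lef_pV2 ?posrE// ler_nat ltnS.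
  - by move=> i; exact: measurable_itv.
  - by move=> i; exact: measurable_funTS.
  - by move=> i t _; rewrite lee_fin powR_ge0.
rewrite -(cvg_lim _ cvgE)//; apply: le_lt_trans (ltry x^-1).
by apply: lime_le; [apply/cvg_ex; eexists; exact: cvgE|exact: nearW].
Qed.

Lemma integrable_Gamma (x : R) : 0 < x ->
  leb.-integrable `]0, +oo[ (fun t : R => (t `^ (x - 1) * expR (- t))%:E).
Proof.
move=> x0.
(* With this [N], t^(x-1) <= t^(N-2) for t >= 1, and e^t >= t^N / N! leaves the integrable tail N!
   t^(-2). *)
pose N := (Num.truncn x).+2.
have xN : x - 1 <= (N.-2)%:R by rewrite lerBlDr natr1 ltW// truncnS_gt.
pose C : R := N`!%:R.
have C0 : 0 <= C by [].
have mg : measurable_fun setT (fun t : measurableTypeR R => t `^ (x - 1) * expR (- t)).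
  apply: measurable_funM; first exact: measurable_powR.
  apply: continuous_measurable_fun => t.
  by apply: continuous_comp; [exact: opp_continuous|exact: continuous_expR].
have tail t : 1 <= t -> t `^ (x - 1) * expR (- t) <= C * t `^ (- 2%:R).
  move=> t1; have t0 : 0 < t by exact: lt_le_trans t1.
  rewrite expRN ler_pdivrMr ?expR_gt0// mulrAC.
  have H : t ^+ N / C <= expR t.
    by have := expR_ge1Dxn (N.-1) (ltW t0); apply: le_trans; rewrite lerDr.
  rewrite ler_pdivrMr in H; last by rewrite ltr0n fact_gt0.
  rewrite (le_trans (ler_powR t1 xN))// powRN powR_mulrn ?(ltW t0)// powR_mulrn ?(ltW t0)//.
  rewrite ler_pdivlMr ?exprn_gt0// -exprD mulrC.
  by rewrite (_ : (N.-2 + 2 = N)%N)// addn2.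
apply/integrableP; split; first by apply: measurable_funTS; exact/measurable_EFinP.
under eq_integral do rewrite gee0_abs ?lee_fin ?mulr_ge0 ?powR_ge0 ?expR_ge0//.
have -> : `]0, +oo[%classic = `]0, 1] `|` `]1, +oo[ :> set R.
  by rewrite -itv_bndbnd_setU// bnd_simp.
rewrite ge0_integral_setU//; last 3 first.
- by apply: measurable_funTS; exact/measurable_EFinP.
- by move=> t _; rewrite lee_fin mulr_ge0 ?powR_ge0 ?expR_ge0.
- apply/eqP/seteqP; split => t //= [].
  by rewrite !in_itv /= andbT => /andP[_ t1] /(le_lt_trans t1); rewrite ltxx.
rewrite lte_add_pinfty//.
- apply: le_lt_trans (integral_powR_itv01_lty x0).
  apply: ge0_le_integral => //.
  + by move=> t _; rewrite lee_fin mulr_ge0 ?powR_ge0 ?expR_ge0.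
  + by apply: measurable_funTS; exact/measurable_EFinP.
  + by apply: measurable_funTS; apply/measurable_EFinP; exact: measurable_powR.
  + move=> t /=; rewrite in_itv /= => /andP[t0 _]; rewrite lee_fin ler_piMr ?powR_ge0//.
    by rewrite -expR0 ler_expR oppr_le0 ltW.
- apply: (@le_lt_trans _ _ (\int[leb]_(t in `[1%R, +oo[) (C%:E * (t `^ (- 2%:R))%:E))%E).
    rewrite -integral_itv_obnd_cbnd; last first.
      apply: measurable_funTS; apply: emeasurable_funM => //.
      by apply/measurable_EFinP; exact: measurable_powR.
    apply: ge0_le_integral => //.
    + by move=> t _; rewrite lee_fin mulr_ge0 ?powR_ge0 ?expR_ge0.
    + by apply: measurable_funTS; exact/measurable_EFinP.
    + apply: measurable_funTS; apply: emeasurable_funM => //.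
      by apply/measurable_EFinP; exact: measurable_powR.
    + move=> t /=; rewrite in_itv /= andbT => t1.
      by rewrite -EFinM lee_fin tail// ltW.
  rewrite ge0_integralZl//.
  + by rewrite (integral_tail_powR (n := 1))// -EFinM ltry.
  + by apply: measurable_funTS; apply/measurable_EFinP; exact: measurable_powR.
  + by move=> t _; rewrite lee_fin powR_ge0.
Qed.

Lemma Gamma_gt0 (x : R) : 0 < x -> 0 < Gamma x.
Proof.
move=> x0; rewrite /Gamma; apply: Rintegral_pos_gt0 => //.
- exact: integrable_Gamma.
- move=> t /=; rewrite in_itv /= andbT => t0.
  by rewrite mulr_gt0 ?expR_gt0// powR_gt0.
- suff : (0 < leb (`]0%R, +oo[%classic : set R))%E by exact.
  by rewrite lebesgue_measure_itv /= ltry; exact: (ltry 0).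
Qed.

End Gamma.

(** * Averages of the beam transform *)

Section beam_average.
Context (R : realType) (n : nat).
Notation RR := (measurableTypeR R).
Notation TT := (n.-tuple RR).
Notation leb := (@lebesgue_measure R).
Notation lam := (lebesgue_tuple R n).
Local Notation D := (`]0, +oo[%classic : set R).
Local Notation delta k := (delta_mx 0 k : 'rV[R]_n).

Lemma Rintegral_translate (b : TT) (g : TT -> R) :
  lam.-integrable setT (EFin \o g) ->
  lam.-integrable setT (EFin \o (g \o taff 1 b)) /\
  \int[lam]_t g (taff 1 b t) = \int[lam]_t g t.
Proof.
move=> ig; have mg : measurable_fun setT (EFin \o g) by case/integrableP : ig.
have E (k : TT -> \bar R) : measurable_fun setT k -> (forall t, 0 <= k t)%E ->
    (\int[lam]_t k (taff 1 b t) = \int[lam]_t k t)%E.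
  by move=> mk k0; rewrite ge0_integral_taff// expr1n invr1 mul1e.
split.
  apply/integrableP; split; first exact: (measurableT_comp mg (measurable_taff 1 b)).
  have mabs : measurable_fun setT (fun t => `|(EFin \o g) t|)%E by exact: measurableT_comp.
  have := E _ mabs (fun t => abse_ge0 _).
  by move=> ->; case/integrableP : ig.
rewrite /Rintegral; congr fine; rewrite integralE [RHS]integralE.
congr (_ - _)%E.
  by rewrite -(E _ (measurable_funepos mg))//; apply: eq_integral => t _; rewrite !funeposE.
by rewrite -(E _ (measurable_funeneg mg))//; apply: eq_integral => t _; rewrite !funenegE.
Qed.

Lemma nrm_rowt (t : TT) : nrm (rowt t) = tnorm t.
Proof. by congr Num.sqrt; apply: eq_bigr => i _; rewrite rowtE expr2. Qed.

Lemma rowt_tscale (u : R) (t : TT) : rowt (tscale u t) = u *: rowt t.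
Proof. by apply/rowP => i; rewrite !mxE tnth_mktuple. Qed.

(** Polar coordinates centred at [x]: u^(2s-1) splits as the Jacobian u^(n-1) times u^(-a), and the
    direction components xi_i, xi_j become e_i, e_j. The factor e_i plays the role of the weight
    constant along rays. *)
Lemma beam_average_pairing (s : R) (F : 'I_n -> 'rV[R]_n -> R) (b : 'rV[R]_n) (r : R)
    (x : 'rV[R]_n) (i : 'I_n) :
  (2 <= n)%N -> 0 < s < 1 -> 0 < r ->
  (forall j, lam.-integrable setT (fun t => (F j (rowt t))%:E)) ->
  (forall j (y : 'rV[R]_n), (forall i, `|y 0 i - b 0 i| < 2 * r) -> F j y = 0) ->
  near_center b r x ->
  \int[@sphere_measure R n]_(t in @unit_sphere R n) (rowt t 0 i *
    \int[leb]_(u in D) (u `^ (2 * s - 1) *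
      \sum_j F j (x + u *: rowt t) * rowt t 0 j)) =
  \int[lam]_t pairing (n%:R - 2 * s) F (beam_kernel R i) x (rowt t).
Proof.
move=> n2 /andP[s0 s1] r0 intF F0 xb.
have n0 : (0 < n)%N by exact: leq_trans n2.
set a := n%:R - 2 * s.
have a0 : 0 <= a.
  have : (2%:R : R) <= n%:R by rewrite ler_nat.
  by rewrite /a; lra.
pose K j : kexpr R n := KM (KL (delta j)) KP.
pose x' : TT := [tuple x 0 k | k < n].
have rx t : rowt (taff 1 x' t) = x + rowt t.
  by apply/rowP => k; rewrite !mxE !tnth_mktuple mul1r addrC.
pose h (t : TT) := pairing a F K x (rowt (taff 1 x' t)).
pose w (t : TT) := dotp (delta i) (rowt t) / nrm (rowt t).
have hE t : h t = \sum_j F j (x + rowt t) *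
    (dotp (delta j) (rowt t) / nrm (rowt t) * nrm (rowt t) `^ (- a)).
  by rewrite /h /pairing rx [x + rowt t]addrC addrK [rowt t + x]addrC.
have mw : measurable_fun setT w.
  have := measurable_keval a (KL (delta i)) (0 : 'rV[R]_n).
  by under eq_fun do rewrite subr0.
(* Since the inverse of 0 is 0, the direction is zero at the origin, as [polar_Rintegral]
   requires. *)
have hz t : tnorm t = 0 -> h t = 0.
  rewrite -nrm_rowt => t0; rewrite hE; apply: big1 => j _.
  by rewrite t0 invr0 mulr0 mul0r mulr0.
have w1 t : `|w t| <= 1.
  rewrite /w dotp_delta normrM normfV (ger0_norm (nrm_ge0 _)).
  have [->|t0] := eqVneq (nrm (rowt t)) 0; first by rewrite invr0 mulr0.
  have tn0 : 0 < nrm (rowt t) by rewrite lt0r t0 nrm_ge0.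
  by rewrite ler_pdivrMr// mul1r; exact: coord_le_nrm.
have nrmZ u (z : 'rV[R]_n) : 0 < u -> nrm (u *: z) = u * nrm z.
  by move=> u0; rewrite /nrm dotpZl dotpZr mulrA -expr2 sqrtrM ?sqr_ge0// sqrtr_sqr gtr0_norm.
have ellZ u k (z : 'rV[R]_n) : 0 < u ->
    dotp (delta k) (u *: z) / nrm (u *: z) = dotp (delta k) z / nrm z.
  by move=> u0; rewrite nrmZ// dotpZr invfM mulrACA divff ?mul1r// gt_eqF.
have wD u t : 0 < u -> w (tscale u t) = w t.
  by move=> u0; rewrite /w rowt_tscale ellZ.
have [ih _] := Rintegral_translate x' (integrable_pairing a0 r0 intF F0 K xb).
have [_ Eb] := Rintegral_translate x' (integrable_pairing a0 r0 intF F0 (beam_kernel R i) xb).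
have mh : measurable_fun setT h by case/integrableP : ih => /measurable_EFinP.
transitivity (\int[lam]_t (w t * h t)); last first.
  rewrite -Eb; apply: eq_Rintegral => t _; rewrite hE mulr_sumr /pairing /=.
  apply: eq_bigr => j _; rewrite rx [x + rowt t]addrC addrK [rowt t + x]addrC.
  by rewrite /w; ring.
rewrite -(polar_Rintegral n0 mh mw ih hz w1 wD) {ih Eb mh mw}.
apply: eq_Rintegral => t /set_mem; rewrite /unit_sphere /= => t1.
have nt1 : nrm (rowt t) = 1 by rewrite nrm_rowt.
rewrite /w dotp_delta nt1 divr1; congr (_ * _).
apply: eq_Rintegral => u /set_mem /=; rewrite in_itv /= andbT => u0.
rewrite hE !mulr_sumr; apply: eq_bigr => j _.
rewrite rowt_tscale ellZ// nrmZ// nt1 divr1 mulr1 dotp_delta.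
have <- : u ^+ n.-1 * u `^ (- a) = u `^ (2 * s - 1).
  rewrite -powR_mulrn ?(ltW u0)// -powRD; last by rewrite (lt0r_neq0 u0) implybT.
  congr (_ `^ _); rewrite /a -subn1 natrB//; ring.
by ring.
Qed.

Lemma beam_average_unique_continuation (s : R) (F : 'I_n -> 'rV[R]_n -> R)
    (b : 'rV[R]_n) (r : R) :
  (2 <= n)%N -> 0 < s < 1 -> s != 1 / 2 -> 0 < r ->
  (forall j, schwartz (F j)) ->
  (forall j (y : 'rV[R]_n), (forall i, `|y 0 i - b 0 i| < 2 * r) -> F j y = 0) ->
  (forall x i, near_center b r x ->
    \int[@sphere_measure R n]_(t in @unit_sphere R n) (rowt t 0 i *
      \int[leb]_(u in D) (u `^ (2 * s - 1) *
        \sum_j F j (x + u *: rowt t) * rowt t 0 j)) = 0) ->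
  forall j y, F j y = 0.
Proof.
move=> n2 s01 s12 r0 sF F0 HA j.
have intF k : lam.-integrable setT (fun t => (F k (rowt t))%:E) by exact: integrable_schwartz.
have /andP[s0 s1] := s01.
have nR : (2%:R : R) <= n%:R by rewrite ler_nat.
set a := n%:R - 2 * s.
have a_gt0 : 0 < a by rewrite /a; lra.
have a0 := ltW a_gt0.
have Hb i : annihilates a F b r (beam_kernel R i).
  by move=> x xb; rewrite -(beam_average_pairing i n2 s01 r0 intF F0 xb); exact: HA.
(* This is [s != 1/2]; the next exclusion, [a != n - 2], amounts to [s != 1]. *)
have a1 : a != n%:R - 1.
  by apply: contra s12 => /eqP; rewrite /a => E; apply/eqP; lra.
have a2 : a != n%:R - 2.
  by apply/eqP; rewrite /a => E; move: s1; rewrite (_ : s = 1) ?ltxx//; lra.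
apply: (annihilates1_kradial_eq0 a_gt0 r0 intF F0); last exact: schwartz_continuous.
(* The diagonal kernel is [kradial 2]; each Laplacian raises the order by 2, with q + 2 - n = p + 2
   - 2s > 0. *)
elim=> [|k IH]; first exact: (annihilates_diag a0 r0 intF F0 j a1 a2 Hb).
have k0 : (0 : R) <= (2 + k.*2)%:R by [].
rewrite doubleS !addnS -addSn -addnS.
apply: (annihilates1_laplace a0 r0 intF F0) => //.
- by rewrite ltr_wpDr.
- by move: k0; rewrite /a; set m : R := (2 + k.*2)%:R => m0; apply/eqP; lra.
Qed.

End beam_average.

(** * Reduction to real and imaginary parts *)

Section complex_parts.
Local Open Scope complex_scope.
Context (R : realType).

Lemma ReZ (r : R) (z : R[i]) : complex.Re (r%:C * z) = r * complex.Re z.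
Proof. by case: z => u v /=; rewrite mul0r subr0. Qed.

Lemma ImZ (r : R) (z : R[i]) : complex.Im (r%:C * z) = r * complex.Im z.
Proof. by case: z => u v /=; rewrite mul0r addr0. Qed.

Lemma Re_sum (I : finType) (g : I -> R[i]) :
  complex.Re (\sum_i g i) = \sum_i complex.Re (g i).
Proof. by elim/big_rec2 : _ => // i u v _ <-; case: (g i) => a b; case: v. Qed.

Lemma Im_sum (I : finType) (g : I -> R[i]) :
  complex.Im (\sum_i g i) = \sum_i complex.Im (g i).
Proof. by elim/big_rec2 : _ => // i u v _ <-; case: (g i) => a b; case: v. Qed.

Lemma Re_Cintegral d (T : measurableType d) (mu : {measure set T -> \bar R})
    (D : set T) (g : T -> R[i]) :
  complex.Re (Cintegral mu D g) = \int[mu]_(x in D) complex.Re (g x).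
Proof. by []. Qed.

Lemma Im_Cintegral d (T : measurableType d) (mu : {measure set T -> \bar R})
    (D : set T) (g : T -> R[i]) :
  complex.Im (Cintegral mu D g) = \int[mu]_(x in D) complex.Im (g x).
Proof. by []. Qed.

(** The constant [c11] is nonzero: both Gamma arguments, (n + 2 - 2s)/2 and s, are positive. *)
Lemma average1_eq0 n (s : R) (f : 'rV[R]_n -> 'rV[R[i]]_n) (x : 'rV[R]_n) i :
  (2 <= n)%N -> 0 < s < 1 -> average1 s f x = 0 ->
  sphere_integral (fun xi => (xi 0 i)%:C * chi1 s f x xi) = 0.
Proof.
move=> n2 /andP[s0 s1] /rowP /(_ i); rewrite !mxE => /eqP.
rewrite mulf_eq0 => /orP[/eqP[/eqP]|/eqP //].
have nR : (2%:R : R) <= n%:R by rewrite ler_nat.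
rewrite /c11 mulf_eq0 oppr_eq0 invr_eq0 !mulf_eq0 !gt_eqF ?powR_gt0 ?pi_gt0//;
  by apply: Gamma_gt0; lra.
Qed.

End complex_parts.

Theorem theorem4p10 (R : realType) (n : nat) (s : R)
    (f : 'rV[R]_n -> 'rV[R[i]]_n) :
  (2 <= n)%N -> 0 < s < 1 -> s != 1 / 2 ->
  schwartz_field f ->
  (exists U : set 'rV[R]_n,
    [/\ open U, U !=set0 &
        forall x, U x ->
          [/\ f x = 0, average0 s f x = 0 & average1 s f x = 0]]) ->
  forall x, f x = 0.
Proof.
move=> n2 s01 s12 sf [U [oU [b Ub] HU]].
have /nbhs_ballP[e /= e0 eU] : nbhs b U by exact: open_nbhs_nbhs.
(* The ball of radius 2r about [b] lies in [U], as does the smaller box from which the points [x]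
   are taken. *)
pose r := e / 2.
have r0 : 0 < r by rewrite divr_gt0.
have e2 : e = 2 * r by rewrite /r mulrC divfK.
have inU (y : 'rV[R]_n) : (forall i, `|y 0 i - b 0 i| < 2 * r) -> U y.
  move=> yb; apply: eU; split => // i j; rewrite (ord1 i) /ball /= distrC e2.
  exact: yb.
have nU x : near_center b r x -> U x.
  by move=> xb; apply: inU => i; apply: lt_trans (xb i) _; lra.
(* The beam transform has real weights, so the real part of the average is the average of the real
   parts. *)
have re y j : complex.Re (f y 0 j) = 0.
  move: j y; apply: (beam_average_unique_continuation
      (F := fun j y => complex.Re (f y 0 j)) n2 s01 s12 r0).
  - by move=> j; have [] := sf j.
  - by move=> j y /inU /HU[-> _ _]; rewrite mxE.
  move=> x i /nU /HU[_ _ /(average1_eq0 i n2 s01)].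
  move=> /(congr1 (@complex.Re R)); rewrite Re_Cintegral => H.
  rewrite -[RHS]H; apply: eq_Rintegral => t _.
  rewrite ReZ Re_Cintegral; congr (_ * _); apply: eq_Rintegral => u _.
  rewrite ReZ Re_sum; congr (_ * _); apply: eq_bigr => j _.
  by rewrite [in RHS]mulrC ReZ mulrC.
have im y j : complex.Im (f y 0 j) = 0.
  move: j y; apply: (beam_average_unique_continuation
      (F := fun j y => complex.Im (f y 0 j)) n2 s01 s12 r0).
  - by move=> j; have [] := sf j.
  - by move=> j y /inU /HU[-> _ _]; rewrite mxE.
  move=> x i /nU /HU[_ _ /(average1_eq0 i n2 s01)].
  move=> /(congr1 (@complex.Im R)); rewrite Im_Cintegral => H.
  rewrite -[RHS]H; apply: eq_Rintegral => t _.
  rewrite ImZ Im_Cintegral; congr (_ * _); apply: eq_Rintegral => u _.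
  rewrite ImZ Im_sum; congr (_ * _); apply: eq_bigr => j _.
  by rewrite [in RHS]mulrC ImZ mulrC.
move=> x; apply/rowP => j; rewrite mxE.
by have := re x j; have := im x j; case: (f x 0 j) => u v /= -> ->.
Qed.
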